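(* Let $p>1$, $q>\max\{p/2-1,0\}$, $\rho\in(0,+\infty)$, and assume that $F$ satisfies: (a0) $F\in C^1([0,+\infty))$, $\lim_{s\to0^+}\frac{F(s)}{s^p}=0$, and $\lim_{s\to+\infty}\frac{F(s)}{s^p}=+\infty$; (a1) for all $s>0$ such that $F(s)>0$ there holds $F'(s)s-pF(s)>0$. Then there exists a solution $(\lambda,u)\in(0,+\infty)\times C^2(\mathbb{R})$ to $$-u''+\lambda u^{p-1}=F'(u)\ \text{ in }\mathbb{R},\qquad \int_{\mathbb{R}}u^q\,\mathrm{d}x=\rho,$$ in each of the following cases: (i) $m_0=0$, $K_0<k_\infty$, and $\rho\in\left(\frac{\pi}{\sqrt{(q-p/2+1)k_\infty}},\frac{\pi}{\sqrt{(q-p/2+1)K_0}}\right)$; (ii) $m_0=0$, $K_\infty<k_0$, and $\rho\in\left(\frac{\pi}{\sqrt{(q-p/2+1)k_0}},\frac{\pi}{\sqrt{(q-p/2+1)K_\infty}}\right)$; (iii) $m_0>0$, $I_F>\frac{\pi}{\sqrt{(q-p/2+1)k_\infty}}$, and $\rho\in\left(\frac{\pi}{\sqrt{(q-p/2+1)k_\infty}},I_F\right)$; (iv) $m_0>0$, $F'(m_0)\ne0$, $I_F<\frac{\pi}{\sqrt{(q-p/2+1)K_\infty}}$, and $\rho\in\left(I_F,\frac{\pi}{\sqrt{(q-p/2+1)K_\infty}}\right)$. Furthermore, $u'\in L^2(\mathbb{R})$, $u$ is non-negative and even, and $\lim_{|x|\to+\infty}u(x)=0$.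
   Context: Definitions: $$K_0:=\limsup_{s\to0^+}\frac{F'(s)s-pF(s)}{s^{2q+2}},\quad k_0:=\liminf_{s\to0^+}\frac{F'(s)s-pF(s)}{s^{2q+2}},$$ $$K_\infty:=\limsup_{s\to+\infty}\frac{F'(s)s-pF(s)}{s^{2q+2}},\quad k_\infty:=\liminf_{s\to+\infty}\frac{F'(s)s-pF(s)}{s^{2q+2}}.$$ $m_0:=\max\{t\ge0:\ F\le0\text{ on }[0,t]\}$; if $m_0>0$, $I_F:=\sqrt2\int_0^{m_0}\frac{s^q}{\sqrt{|F(s)|}}\,\mathrm{d}s\in(0,+\infty]$ (the integrand being $+\infty$ where $s>0$ and $F(s)=0$). Conventions: $\frac10=+\infty$ and $\frac1{+\infty}=0$ (so $\pi/\sqrt{c\cdot 0}=+\infty$ and $\pi/\sqrt{c\cdot(+\infty)}=0$ for $c>0$). *)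

(* Defs.v *)
From HB Require Import structures.
From mathcomp Require Import all_boot all_order all_algebra.
From mathcomp Require Import all_classical all_reals all_analysis.
Set Implicit Arguments.
Unset Strict Implicit.
Unset Printing Implicit Defensive.
Import Order.TTheory GRing.Theory Num.Theory.
Import numFieldNormedType.Exports.
Local Open Scope classical_set_scope.
Local Open Scope ring_scope.

(* A function on [0, +oo) is a total F : R -> R of which no definition below
   reads the values at negative arguments. *)

(* Derivative relative to [0, +oo): the two-sided derivative at s > 0, the
   right derivative at s = 0. *)
Definition ray_derive (R : realType) (F : R -> R) (s : R) : R :=
  lim ((F t - F s) / (t - s) @[t --> within `[0, +oo[ s^']).

Definition C1_ray (R : realType) (F : R -> R) : Prop :=
  (forall s : R, 0 <= s ->
     cvg ((F t - F s) / (t - s) @[t --> within `[0, +oo[ s^'])) /\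
  {within `[0, +oo[, continuous (ray_derive F)}.

Definition C2 (R : realType) (u : R -> R) : Prop :=
  [/\ forall x : R, derivable u x 1,
      forall x : R, derivable (u^`())%classic x 1
    & continuous (u^`(2))%classic].

Definition quot (R : realType) (p q : R) (F : R -> R) (s : R) : R :=
  (ray_derive F s * s - p * F s) / s `^ (2 * q + 2).

Definition K_0 (R : realType) (p q : R) (F : R -> R) : \bar R :=
  limf_esup (EFin \o quot p q F) 0^'+.

Definition k_0 (R : realType) (p q : R) (F : R -> R) : \bar R :=
  limf_einf (EFin \o quot p q F) 0^'+.

Definition K_oo (R : realType) (p q : R) (F : R -> R) : \bar R :=
  limf_esup (EFin \o quot p q F) +oo.

Definition k_oo (R : realType) (p q : R) (F : R -> R) : \bar R :=
  limf_einf (EFin \o quot p q F) +oo.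

(* The supremum is a maximum as soon as F is continuous on [0, +oo), F 0 <= 0
   and F is positive somewhere on [0, +oo); see m_0P. *)
Definition m_0 (R : realType) (F : R -> R) : R :=
  sup [set t : R | 0 <= t /\ forall s : R, 0 <= s <= t -> F s <= 0].

(* Inversion in \bar R satisfies 0^-1 = +oo and +oo^-1 = 0, so that the
   integrand is +oo where s > 0 and F s = 0. *)
Definition I_F (R : realType) (q : R) (F : R -> R) : \bar R :=
  ((Num.sqrt 2)%:E *
   \int[lebesgue_measure]_(s in `[0%R, m_0 F])
     ((s `^ q)%:E / (Num.sqrt `|F s|)%:E))%E.

(* pi / sqrt ((q - p / 2 + 1) * k), equal to +oo at k = 0 and to 0 at
   k = +oo when q > p / 2 - 1. *)
Definition threshold (R : realType) (p q : R) (k : \bar R) : \bar R :=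
  (pi%:E / sqrte ((q - p / 2 + 1)%:E * k))%E.

Lemma m_0P (R : realType) (F : R -> R) :
  {within `[0, +oo[, continuous F} -> F 0 <= 0 ->
  (exists2 t : R, 0 <= t & 0 < F t) ->
  [/\ 0 <= m_0 F,
      forall s : R, 0 <= s <= m_0 F -> F s <= 0
    & forall t : R, 0 <= t -> (forall s : R, 0 <= s <= t -> F s <= 0) ->
        t <= m_0 F].
Proof.
move=> Fc F0 [T T0 FT].
set A := [set t : R | 0 <= t /\ forall s : R, 0 <= s <= t -> F s <= 0].
have A0 : A 0.
  by split=> // s s0; rewrite (le_anti s0) in F0 *.
have ubA : ubound A T.
  move=> t [t0 ht]; rewrite leNgt; apply/negP => Tt.
  by have := ht T; rewrite T0 (ltW Tt) leNgt FT => /(_ isT).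
have supA : has_sup A by split; [exists 0 | exists T].
have le_m t : A t -> t <= m_0 F by move=> At; exact: (sup_upper_bound supA).
have m0 : 0 <= m_0 F by exact: le_m.
split=> // [s /andP[s0]|t t0 ht]; last by apply: le_m.
have below r : 0 <= r -> r < m_0 F -> F r <= 0.
  move=> r0; rewrite -subr_gt0 => /sup_adherent/(_ supA)[t [_ ht]].
  by rewrite opprB addrCA subrr addr0 => /ltW rt; apply: ht; rewrite r0.
rewrite le_eqVlt => /predU1P[->{s s0}|]; last exact: below.
have [m00|m_gt0] := leP (m_0 F) 0.
  by have -> : m_0 F = 0 by apply/eqP; rewrite eq_le m00.
have Fm : F x @[x --> (m_0 F)^'-] --> F (m_0 F).
  apply: cvg_at_left_filter.
  by apply: ((continuous_within_itvcyP 0 F).1 Fc).1; rewrite in_itv /= m_gt0.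
rewrite leNgt; apply/negP => Fm_gt0; near (m_0 F)^'- => r.
have : 0 < F r by near: r; exact: (cvgr_gt _ Fm).
apply/negP; rewrite -leNgt; apply: below; first by near: r; exact: nbhs_left_ge.
by near: r; exact: nbhs_left_lt.
Unshelve. all: by end_near. Qed.

(* Main.v *)
Require Import Defs.
From HB Require Import structures.
From mathcomp Require Import all_boot all_order all_algebra.
From mathcomp Require Import all_classical all_reals all_analysis.
From mathcomp Require Import ring lra measurable_realfun.
Set Implicit Arguments.
Unset Strict Implicit.
Unset Printing Implicit Defensive.
Import Order.TTheory GRing.Theory Num.Theory.
Import numFieldNormedType.Exports.
Local Open Scope classical_set_scope.
Local Open Scope ring_scope.

(* Put G s = F s / s^p and a = q - p/2 + 1. By (a1), G increases from 0 to
   +oo on ]m_0, +oo[. For m > m_0 and lambda = p G(m), the energy identity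
   u'^2 / 2 = H(u) with H s = s^p (G m - G s) has a solution with maximum m,
   obtained by inverting the time map s |-> int_s^m dr / sqrt (2 H r); where H
   degenerates (at the maximum, and at the ends of the support when p < 2) u is
   C^2 because u', u'' extend continuously. Its mass is
     M(m) = sqrt 2 * int_0^m s^(a-1) / sqrt (G m - G s) ds,
   which is finite and continuous in m, so it is enough to find masses below
   and above rho. Since G' s = Q(s) s^(2a-1), where Q is the quotient whose
   limits are K_0, k_0, K_oo, k_oo, a bound Q >= k or Q <= K compares M with
   int_0^m s^(a-1) / sqrt ((m^(2a) - s^(2a)) k / (2a)) ds = pi / sqrt (2 a k),
   which settles m -> 0 and m -> +oo; for m -> m_0 > 0 the mass tends to I_F by
   monotone convergence. *)

(** * Derivatives and improper integrals *)

(** The hard step is the continuity of M, whose integrand is singular at the moving endpoint s = m.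
    A cut at a fixed S between m_0 and m separates two effects. On ]0, S[ the densities of nearby
    maxima are dominated by that of a smaller maximum. On ]S, m[ the inequality G'(m) > 0 gives a
    local bound G'(t) >= k t^(2a-1), and the power comparison turns the tail into an arctangent that
    vanishes as S -> m, with the same k for all nearby maxima. The same cut gives finiteness and the
    limits at +oo. At m_0 > 0 the cut is S = m_0 itself. A mass above rho only needs the part over
    ]0, m_0[, whereas a mass below rho needs the tail over ]m_0, m[ to vanish, hence G'(m_0) > 0:
    this is what F'(m_0) <> 0 provides in case (iv). The condition q > p/2 - 1 says a > 0, the
    integrability of s^(a-1) at 0; lambda > 0 because G(m) > 0 for m > m_0. Nothing is claimed about
    monotonicity of M: the maximum m comes from the intermediate value theorem. *)

Lemma is_derive1_punctured (R : realType) (f g : R -> R) (x : R) :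
  {for x, continuous f} -> {for x, continuous g} ->
  (\forall y \near x^', is_derive (y : R) (1 : R) f (g y)) -> is_derive x 1 f (g x).
Proof.
move=> fx gx /nbhs_ballP[e /= e0 fg].
have fe y : y != x -> `|x - y| < e -> is_derive y 1 f (g y).
  by move=> yx xy; exact: fg.
have cf y : `|x - y| < e -> {for y, continuous f}.
  have [->//|yx xy] := eqVneq y x.
  by apply/differentiable_continuous/derivable1_diffP; have [] := fe _ yx xy.
(* The mean value theorem turns each difference quotient at [x] into a value [g c] with [c] at least
   as close to [x]; continuity of [g] at [x] then gives the limit. *)
have mvt y : y != x -> `|x - y| < e ->
    exists2 c, `|x - c| <= `|x - y| & f y - f x = g c * (y - x).
  move=> yx xy; have [xLy|yLx|/eqP] := ltgtP x y; last by rewrite eq_sym (negbTE yx).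
    have := xy; rewrite distrC gtr0_norm ?subr_gt0// => xye.
    have [z||c /[!in_itv]/= /andP[xc cy] E] := @MVT R f g x y xLy.
    - rewrite in_itv/= => /andP[xz zy]; apply: fe; first by rewrite gt_eqF.
      by rewrite distrC gtr0_norm ?subr_gt0//; lra.
    - apply: continuous_in_subspaceT => z /set_mem /=; rewrite in_itv/= => /andP[xz zy].
      by apply: cf; rewrite distrC ger0_norm ?subr_ge0//; lra.
    - by exists c => //; rewrite distrC gtr0_norm ?subr_gt0//; lra.
  have := xy; rewrite gtr0_norm ?subr_gt0// => xye.
  have [z||c /[!in_itv]/= /andP[yc cx] E] := @MVT R f g y x yLx.
  - rewrite in_itv/= => /andP[yz zx]; apply: fe; first by rewrite lt_eqF.
    by rewrite gtr0_norm ?subr_gt0//; lra.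
  - apply: continuous_in_subspaceT => z /set_mem /=; rewrite in_itv/= => /andP[yz zx].
    by apply: cf; rewrite ger0_norm ?subr_ge0//; lra.
  - exists c; first by rewrite gtr0_norm ?subr_gt0//; lra.
    by rewrite -(opprB x y) -(opprB (f x)) E mulrN.
suff H : (fun h => h^-1 *: ((f \o shift x) h%:A - f x)) @ 0^' --> g x.
  split; first by apply/cvg_ex; exists (g x).
  by apply/cvg_lim => //; exact: H.
apply/cvgrPdist_lt => eps eps0.
have /cvgrPdist_lt/(_ eps eps0)/nbhs_ballP[d /= d0 gd] := gx.
near=> h => /=.
have h0 : h != 0 by near: h; exact: nbhs_dnbhs_neq.
have hde : `|h| < Num.min d e.
  near: h; apply: dnbhs0_lt; by rewrite lt_min d0 e0.
have [hd he] : `|h| < d /\ `|h| < e by move: hde; rewrite lt_min => /andP[].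
have [||c xc ->] := mvt (h%:A + x).
- by rewrite -subr_eq0 addrK /GRing.scale/= mulr1.
- by rewrite opprD addrCA subrr addr0 normrN /GRing.scale/= mulr1.
rewrite addrK /GRing.scale/= mulr1 mulrCA mulVf// mulr1; apply: gd.
by rewrite /ball/=; apply: le_lt_trans xc _; rewrite opprD addrCA subrr addr0 normrN /GRing.scale/= mulr1.
Unshelve. all: by end_near. Qed.

(** Around any point, in the list or not, a punctured neighbourhood misses the finite list. Thus
    nothing has to be differentiated by hand at the maximum or at the ends of the support:
    continuity of the function and of its candidate derivative is enough there. *)
Lemma is_derive1_off_seq (R : realType) (f g : R -> R) (s : seq R) :
  continuous f -> continuous g ->
  (forall x : R, x \notin s -> is_derive x 1 f (g x)) ->
  forall x : R, is_derive x 1 f (g x).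
Proof.
move=> cf cg fg x; apply: is_derive1_punctured; [exact: cf|exact: cg|].
suff H : \forall y \near x^', (y : R) \notin s by near=> y; apply: fg; near: y.
elim: s {fg} => [|z s IH]; first exact: nearW.
have xz : \forall y \near x^', y != z.
  have [->|xz] := eqVneq z x; first exact: nbhs_dnbhs_neq.
  have : \forall y \near x^', `|x - y| < `|x - z|.
    by apply: nbhs_dnbhs; apply: nbhsx_ballx; rewrite normr_gt0 subr_eq0 eq_sym.
  by apply: filterS => y; apply: contraTneq => ->; rewrite ltxx.
by near=> y; rewrite inE negb_or; apply/andP; split; near: y.
Unshelve. all: by end_near. Qed.

(** The integrand may blow up at both ends. The fundamental theorem is applied on compact intervals
    exhausting []a, b[]; monotone convergence handles the integrals and continuity of [Phi] at the
    ends handles the increments. *)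
Lemma ge0_FTC2_oo (R : realType) (f Phi : R -> R) (a b : R) : a < b ->
  (forall x, x \in `]a, b[ -> 0 <= f x) ->
  {in `]a, b[, continuous f} ->
  {within `[a, b], continuous Phi} ->
  (forall x, x \in `]a, b[ -> is_derive x 1 Phi (f x)) ->
  (\int[lebesgue_measure]_(x in `]a, b[) (f x)%:E = (Phi b - Phi a)%:E)%E.
Proof.
move=> ab f0 cf cPhi dPhi.
(* The [n.+3] keeps [d n] at most a third of the length, so that no truncated interval
   degenerates. *)
pose d n : R := (b - a) / n.+3%:R.
have d0 n : 0 < d n by rewrite divr_gt0 ?subr_gt0.
have dS n m : (n <= m)%N -> d m <= d n.
  move=> nm; rewrite ler_pM2l ?subr_gt0// lef_pV2 ?posrE//.
  by rewrite ler_nat !ltnS.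
have dab n : a + d n < b - d n.
  have : d n * 3 <= b - a.
    by rewrite /d mulrAC ler_pdivrMr// ler_pM2l ?subr_gt0// ler_nat.
  by have := d0 n; lra.
have dcvg : d n @[n --> \oo] --> 0.
  rewrite -(mulr0 (b - a)); apply: cvgMl_tmp => //.
  have := @cvg_harmonic R; rewrite -(cvg_shiftn 2)/=.
  by under eq_fun do rewrite addn2.
pose I n : set R := `[a + d n, b - d n]%classic.
have IU : `]a, b[%classic = \bigcup_n I n.
  apply/seteqP; split=> x /=; last first.
    case=> n _; rewrite /I/= !in_itv/= => /andP[ax xb].
    by have := d0 n; move=> dn; apply/andP; split; lra.
  rewrite in_itv/= => /andP[ax xb].
  have e0 : 0 < Num.min (x - a) (b - x) by rewrite lt_min !subr_gt0 ax.
  have [n _ /(_ n (leqnn n))] := cvgr_lt _ dcvg _ e0.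
  rewrite lt_min => /andP[h1 h2].
  by exists n => //; rewrite /I/= in_itv/=; apply/andP; split; lra.
have Isub n x : I n x -> x \in `]a, b[.
  by move=> Inx; suff : `]a, b[%classic x by []; rewrite IU; exists n.
have cfn n : {within I n, continuous f}.
  by apply: continuous_in_subspaceT => x /set_mem /Isub xab; exact: cf.
have EI n : (\int[lebesgue_measure]_(x in I n) (f x)%:E =
             (Phi (b - d n) - Phi (a + d n))%:E)%E.
  have Ioo x : x \in `]a + d n, b - d n[ -> x \in `]a, b[.
    by move=> xI; apply: (Isub n); exact: subset_itv_oo_cc.
  have cP x : x \in `]a, b[ -> {for x, continuous Phi}.
    by move=> /dPhi[dx _]; exact/differentiable_continuous/derivable1_diffP.
  rewrite (@continuous_FTC2 _ f Phi)//; last first.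
    by move=> x /Ioo/dPhi[_ <-]; rewrite derive1E.
  split; first by move=> x /Ioo/dPhi[].
    apply: cvg_at_right_filter; apply: cP; apply: (Isub n).
    by rewrite /I /= in_itv/= lexx ltW.
    apply: cvg_at_left_filter; apply: cP; apply: (Isub n).
    by rewrite /I /= in_itv/= lexx ltW.
  exact: cfn.
have := @ge0_nondecreasing_set_cvg_integral _ (measurableTypeR R) R I (EFin \o f) lebesgue_measure.
rewrite -IU => H.
have {}H : (Phi (b - d n) - Phi (a + d n))%:E @[n --> \oo] -->
    (\int[lebesgue_measure]_(x in `]a, b[) (f x)%:E)%E.
  rewrite (_ : (fun n => _) = fun n => \int[lebesgue_measure]_(x in I n) (f x)%:E)%E; last first.
    by apply/funext => n; rewrite EI.
  apply: H.
  - move=> n m nm; apply/subsetPset; apply: subset_itv; rewrite bnd_simp.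
      by rewrite lerD2l dS.
    by rewrite lerD2l lerN2 dS.
  - by move=> i; exact: measurable_itv.
  - by move=> n; apply/measurable_EFinP; apply: (subspace_continuous_measurable_fun _ (cfn n)); exact: measurable_itv.
  - by move=> n x /Isub xab; rewrite /= lee_fin f0.
have H' : (Phi (b - d n) - Phi (a + d n))%:E @[n --> \oo] --> (Phi b - Phi a)%:E.
  apply: cvg_EFin; first exact: nearW.
  have /(continuous_within_itvP _ ab)[_ Pa Pb] := cPhi.
  apply: cvgB.
    apply: ((cvg_at_leftP _ _ _).1 Pb); split=> [n|]; first by have := d0 n; lra.
    by rewrite -[X in _ --> X]subr0; apply: cvgB => //; exact: cvg_cst.
  apply: ((cvg_at_rightP _ _ _).1 Pa); split=> [n|]; first by have := d0 n; lra.
  by rewrite -[X in _ --> X]addr0; apply: cvgD => //; exact: cvg_cst.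
by rewrite -(cvg_lim _ H)//; exact/cvg_lim.
Qed.

Lemma continuous_powR_gt0 (R : realType) (a s : R) : 0 < s ->
  {for s, continuous (fun x : R => x `^ a)}.
Proof.
move=> s0; apply/differentiable_continuous/derivable1_diffP.
by apply: ex_derive; apply: is_derive1_powR.
Qed.

(** Powers are taken of [|s|] to be continuous on both sides of 0, a point where antiderivatives and
    potentials are evaluated below. *)
Lemma continuous_powR_norm (R : realType) (a : R) : 0 < a ->
  continuous (fun s : R => `|s| `^ a).
Proof.
move=> a0 s; have [->|s0] := eqVneq s 0.
  rewrite /continuous_at normr0 powR0 ?gt_eqF//.
  apply/cvgrPdist_lt => e e0; near=> t.
  rewrite sub0r normrN ger0_norm ?powR_ge0//.
  rewrite -[ltRHS]powRr1 ?ltW// -(mulVf (lt0r_neq0 a0)) powRrM.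
  rewrite gt0_ltr_powR ?nnegrE ?powR_ge0//.
  near: t; apply: (@nbhs0_lt R R); exact: powR_gt0.
apply: (@continuous_comp R R R (fun s : R => `|s|) (fun x : R => x `^ a) s).
  exact: norm_continuous.
by apply: continuous_powR_gt0; rewrite normr_gt0.
Unshelve. all: by end_near. Qed.

(** An antiderivative is -arccos(s^a / m^a) / a. It is written with the half-angle formula arccos x
    = 2 atan (sqrt ((1 - x) / (1 + x))), which is continuous up to s = m because [atan] and
    [Num.sqrt] are continuous everywhere. *)
Lemma integral_arcsin_powR (R : realType) (a S m : R) : 0 < a -> 0 <= S < m ->
  (\int[lebesgue_measure]_(s in `]S, m[)
     (s `^ (a - 1) / Num.sqrt (m `^ (2 * a) - s `^ (2 * a)))%:E =
   (2 / a * atan (Num.sqrt ((m `^ a - S `^ a) / (m `^ a + S `^ a))))%:E)%E.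
Proof.
move=> a0 /andP[S0 Sm].
have m0 : 0 < m by exact: le_lt_trans Sm.
have A0 : 0 < m `^ a by exact: powR_gt0.
pose w (s : R) : R := (m `^ a - `|s| `^ a) / (m `^ a + `|s| `^ a).
pose Phi (s : R) : R := - (2 / a * atan (Num.sqrt (w s))).
have den s : 0 < m `^ a + `|s| `^ a by rewrite ltr_wpDr ?powR_ge0.
have cPhi : continuous Phi.
  move=> s; apply: cvgN; apply: cvgM; first exact: cvg_cst.
  apply: (@continuous_comp _ _ _ (Num.sqrt \o w) (@atan R)); last exact: continuous_atan.
  apply: (@continuous_comp _ _ _ w Num.sqrt); last exact: sqrt_continuous.
  apply: cvgM.
    by apply: cvgB; [exact: cvg_cst|exact: continuous_powR_norm].
  apply: cvgV; first by rewrite gt_eqF.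
  by apply: cvgD; [exact: cvg_cst|exact: continuous_powR_norm].
have sp s : s \in `]S, m[ -> 0 < s /\ s `^ a < m `^ a.
  rewrite in_itv/= => /andP[Ss sm]; have s0 : 0 < s by exact: le_lt_trans Ss.
  by split=> //; rewrite gt0_ltr_powR ?nnegrE// ltW.
have sqE s : 0 < s -> s `^ (2 * a) = (s `^ a) ^+ 2.
  by move=> s0; rewrite mulrC powRrM -powR_mulrn ?powR_ge0.
pose f s := s `^ (a - 1) / Num.sqrt (m `^ (2 * a) - s `^ (2 * a)).
have f0 s : s \in `]S, m[ -> 0 <= f s.
  by move=> _; rewrite divr_ge0 ?powR_ge0 ?sqrtr_ge0.
have cf : {in `]S, m[, continuous f}.
  move=> s sI; have [s0 sm] := sp s sI.
  apply: cvgM; first exact: continuous_powR_gt0.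
  apply: cvgV.
    rewrite gt_eqF// sqrtr_gt0 subr_gt0 !sqE//.
    by rewrite ltr_pXn2r ?nnegrE ?powR_ge0.
  apply: (@continuous_comp _ _ _ (fun s => m `^ (2 * a) - s `^ (2 * a)) Num.sqrt); last exact: sqrt_continuous.
  by apply: cvgB; [exact: cvg_cst|exact: continuous_powR_gt0].
have dPhi s : s \in `]S, m[ -> is_derive s 1 Phi (f s).
  move=> sI; have [s0 sm] := sp s sI.
  pose w' (s : R) : R := (m `^ a - s `^ a) / (m `^ a + s `^ a).
  pose Phi' (s : R) : R := - (2 / a * atan (Num.sqrt (w' s))).
  have PE : {near s, Phi' =1 Phi}.
    near=> t; rewrite /Phi /Phi' /w /w' ger0_norm// ltW//.
    by near: t; exact: lt_nbhsr.
  apply: (near_eq_is_derive PE).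
  have dp := is_derive1_powR a s0.
  have den' : 0 < m `^ a + s `^ a by rewrite ltr_wpDr ?powR_ge0.
  have w0 : 0 < w' s by rewrite divr_gt0 ?subr_gt0.
  have dN := is_deriveB (is_derive_cst (m `^ a) s 1) dp.
  have dD := is_deriveD (is_derive_cst (m `^ a) s 1) dp.
  have dV := @is_deriveV _ (cst (m `^ a) + @powR R ^~ a) _ _ _ (lt0r_neq0 den') dD.
  have dw := is_deriveM dN dV.
  have dsw := @is_derive1_comp _ Num.sqrt w' _ _ _ (is_derive1_sqrt w0) dw.
  have dat := @is_derive1_comp _ (@atan R) (Num.sqrt \o w') _ _ _ (is_derive1_atan (Num.sqrt (w' s))) dsw.
  have dPhi := is_deriveN (is_deriveZ (2 / a) dat).
  apply: (is_derive_eq dPhi).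
  rewrite /f !sqE//; set r := Num.sqrt (w' s).
  have r0 : r != 0 by rewrite gt_eqF// sqrtr_gt0.
  have r2 : r ^+ 2 = (m `^ a - s `^ a) / (m `^ a + s `^ a) by rewrite sqr_sqrtr ?ltW.
  (* Both square roots are expressed through the single quantity [r], so that what remains is a
     rational identity once [r ^+ 2] is replaced. *)
  have -> : Num.sqrt ((m `^ a) ^+ 2 - (s `^ a) ^+ 2) = (m `^ a + s `^ a) * r.
    rewrite -[RHS]ger0_norm; last by rewrite mulr_ge0 ?sqrtr_ge0 ?ltW.
    rewrite -sqrtr_sqr exprMn r2; congr Num.sqrt; field.
    exact: lt0r_neq0.
  rewrite sub0r add0r /GRing.scale/= r2.
  rewrite !fctE; field.
  rewrite r0 !lt0r_neq0//=; lra.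
have E := ge0_FTC2_oo Sm f0 cf (continuous_subspaceT cPhi) dPhi.
apply: (eq_trans E); congr EFin.
rewrite /Phi /w (gtr0_norm m0) (ger0_norm S0) subrr mul0r sqrtr0 atan0.
by rewrite mulr0 oppr0 sub0r opprK.
Unshelve. all: by end_near. Qed.

(** * Homoclinic profiles *)

Lemma cvg_within_comp (R : realType) (A : set R) (N u : R -> R) (F : set_system R)
    (FF : Filter F) (l : R) :
  {within A, continuous N} -> (forall x, A (u x)) -> A l -> u @ F --> l ->
  N (u x) @[x --> F] --> N l.
Proof.
move=> /subspace_continuousP cN Au Al cu.
apply: (cvg_comp _ _ _ (cN _ Al)) => B [/= e e0 eB].
near=> y; apply: eB; last exact: Au.
by near: y; have /cvgrPdist_lt := cu; apply.
Unshelve. all: by end_near. Qed.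

(** The jump of the sign at 0 is absorbed by the zero of [w]; elsewhere the sign is locally
    constant. The odd functions attached to an even profile, its derivative and its cumulated mass,
    have this form. *)
Lemma continuous_sgrM (R : realType) (w : R -> R) : continuous w -> w 0 = 0 ->
  continuous (fun x : R => Num.sg x * w x).
Proof.
move=> cw w0 x; have [->|x0] := eqVneq x 0.
  rewrite /continuous_at sgr0 mul0r; apply/cvgrPdist_lt => e e0.
  have /cvgrPdist_lt/(_ e e0) := cw 0; rewrite w0.
  apply: filterS => y; rewrite !sub0r !normrN normrM; apply: le_lt_trans.
  by rewrite ler_piMl// normr_sg; case: (y != 0).
have sgE : \forall y \near x, Num.sg y = Num.sg x.
  have [x1|x1|/eqP] := ltgtP x 0; last by rewrite (negbTE x0).
    by near=> y; rewrite !ltr0_sg//; near: y; exact: lt_nbhsl.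
  by near=> y; rewrite !gtr0_sg//; near: y; exact: lt_nbhsr.
apply: (@cvg_trans _ ((fun y => Num.sg x * w y) @ x)).
  by apply: near_eq_cvg; near=> y; congr (_ * _); apply/esym; near: y.
exact: (cvgM (cvg_cst (Num.sg x)) (cw x)).
Unshelve. all: by end_near. Qed.

(** * Inverting a decreasing time map *)

Section time_map.
Variables (R : realType) (m : R) (tau g : R -> R).
Hypothesis m_gt0 : 0 < m.
Hypothesis tau_m : tau m = 0.
Hypothesis tau_left : tau s @[s --> m^'-] --> 0.
Hypothesis tau_d : forall s, 0 < s < m -> is_derive s 1 tau (- g s).
Hypothesis g_gt0 : forall s, 0 < s < m -> 0 < g s.

Let tau_cont s : 0 < s < m -> {for s, continuous tau}.
Proof.
by move=> /tau_d[dt _]; exact/differentiable_continuous/derivable1_diffP.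
Qed.

Let tau_cvg_left s : 0 < s <= m -> tau x @[x --> s^'-] --> tau s.
Proof.
move=> /andP[s0]; rewrite le_eqVlt => /predU1P[->|sm]; first by rewrite tau_m.
by apply: cvg_at_left_filter; apply: tau_cont; rewrite s0.
Qed.

Let tau_decr s t : 0 < s -> s < t -> t <= m -> tau t < tau s.
Proof.
move=> s0 st tm.
have [||c /[!in_itv]/= /andP[sc ct] E] := @MVT R tau (fun s => - g s) s t st.
- move=> x; rewrite in_itv/= => /andP[sx xt]; apply: tau_d.
  by rewrite (lt_trans s0)//= (lt_le_trans xt).
- apply/(continuous_within_itvP _ st); split.
  + move=> x; rewrite in_itv/= => /andP[sx xt]; apply: tau_cont.
    by rewrite (lt_trans s0)//= (lt_le_trans xt).
  + by apply: cvg_at_right_filter; apply: tau_cont; rewrite s0 (lt_le_trans st).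
  + by apply: tau_cvg_left; rewrite (lt_trans s0).
rewrite -subr_lt0 E pmulr_llt0 ?subr_gt0// oppr_lt0 g_gt0//.
by rewrite (lt_trans s0)//= (lt_le_trans ct).
Qed.

(** The inverse of [tau] is taken as the supremum of a superlevel set. With 0 adjoined the set is
    never empty, and the profile is 0 once [|x|] exceeds all values of [tau]: compactly supported
    and everywhere positive profiles are covered at once. *)
Let lev (x : R) : set R := [set s | s = 0 \/ 0 < s <= m /\ `|x| <= tau s].

Definition profile (x : R) : R := sup (lev x).

Let lev_sup x : has_sup (lev x).
Proof.
split; first by exists 0; left.
by exists m => s [->|[/andP[]//]]; exact: ltW.
Qed.

Lemma profile_ge0 x : 0 <= profile x.
Proof. by apply: (sup_upper_bound (lev_sup x)); left. Qed.

Lemma profile_le x : profile x <= m.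
Proof.
by apply: ge_sup; [exists 0; left|move=> s [->|[/andP[]//]]; exact: ltW].
Qed.

Lemma profileN x : profile (- x) = profile x.
Proof. by rewrite /profile /lev; under eq_set do rewrite normrN. Qed.

Lemma profile_norm x : profile `|x| = profile x.
Proof. by rewrite /profile /lev normr_id. Qed.

(** The adjunction behind all later facts on [profile]. If [tau s < |x|], left continuity gives some
    [t < s] with [tau t < |x|], and [tau] decreases, so [t] already bounds the level set; the
    supremum is thus strictly below [s]. *)
Lemma profile_ge (s x : R) : 0 < s <= m -> (s <= profile x) = (`|x| <= tau s).
Proof.
move=> sm; apply/idP/idP; last first.
  by move=> xs; apply: (sup_upper_bound (lev_sup x)); right.
apply: contraTT; rewrite -!ltNge => sx.
have /andP[s0 sm'] := sm.
have [t [t0 ts tx]] : exists t, [/\ 0 < t, t < s & tau t < `|x|].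
  have := cvgr_lt _ (tau_cvg_left sm) _ sx => h.
  near s^'- => t; exists t; split; near: t.
  + exact: nbhs_left_gt.
  + exact: nbhs_left_lt.
  + exact: h.
apply: le_lt_trans ts; apply: ge_sup; first by exists 0; left.
move=> r [->|[/andP[r0 rm] xr]]; first exact: ltW.
rewrite leNgt; apply/negP => tr.
by have := tau_decr t0 tr rm; rewrite ltNge (le_trans (ltW tx)).
Unshelve. all: by end_near. Qed.

(** If [tau] exceeded [|x|] at the supremum, it would still do so slightly to the right by
    continuity, and the supremum would be larger. The level [m] is excluded beforehand, because
    [tau m = 0]. *)
Lemma tau_profile x : 0 < profile x -> tau (profile x) = `|x|.
Proof.
move=> u0; have um := profile_le x.
have := profile_ge x (s := profile x); rewrite u0 um lexx => /(_ isT)/esym xu.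
apply/eqP; rewrite eq_le xu andbT leNgt; apply/negP => xlt.
have ultm : profile x < m.
  rewrite lt_neqAle um andbT; apply: contraTneq xlt => ->.
  by rewrite tau_m -leNgt.
have h : tau t @[t --> (profile x)^'+] --> tau (profile x).
  by apply: cvg_at_right_filter; apply: tau_cont; rewrite u0.
have h' := cvgr_gt _ h _ xlt.
near (profile x)^'+ => t.
have : t <= profile x.
  rewrite profile_ge.
    by apply: ltW; near: t; exact: h'.
  apply/andP; split; last by apply: ltW; near: t; exact: nbhs_right_lt.
  by apply: (lt_trans u0); near: t; exact: nbhs_right_gt.
by rewrite leNgt => /negP; apply; near: t; exact: nbhs_right_gt.
Unshelve. all: by end_near. Qed.

Lemma profile_tau (s x : R) : 0 < s <= m -> `|x| = tau s -> profile x = s.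
Proof.
move=> sm xs; have /andP[s0 _] := sm.
have su : s <= profile x by rewrite profile_ge// xs.
apply/eqP; rewrite eq_le su andbT leNgt; apply/negP => slt.
have := tau_decr s0 slt (profile_le x).
by rewrite tau_profile ?(lt_trans s0)// xs ltxx.
Qed.

Lemma profile0 : profile 0 = m.
Proof. by apply: profile_tau; rewrite ?m_gt0 ?lexx// normr0 tau_m. Qed.

Lemma profile_ltm (x : R) : x != 0 -> profile x < m.
Proof.
move=> x0; rewrite ltNge profile_ge ?m_gt0 ?lexx// tau_m -ltNge normr_gt0//.
Qed.

Lemma continuous_profile : continuous profile.
Proof.
suff C (x : R) : profile y @[y --> x] --> profile x by move=> x; exact: C.
apply/cvgrPdist_lt => e e0.
have up : \forall y \near x, profile y < profile x + e.
  have [lt|le] := ltP m (profile x + e).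
    by near=> y; exact: le_lt_trans (profile_le y) lt.
  have se : 0 < profile x + e <= m by rewrite le andbT ltr_wpDl ?profile_ge0.
  have : tau (profile x + e) < `|x| by rewrite ltNge -profile_ge// -ltNge ltrDl.
  move=> /(cvgr_gt _ (@norm_continuous _ _ x)).
  by apply: filterS => y hy; rewrite ltNge profile_ge// -ltNge.
have lo : \forall y \near x, profile x - e < profile y.
  (* [profile_ge] yields only a large inequality at a given level; going through the level lowered
     by [e / 2] leaves room for the strict bound. *)
  have [lt|le] := ltP (profile x - e / 2) 0.
    near=> y; apply: lt_le_trans (profile_ge0 y); lra.
  have [eq0|s0] := eqVneq (profile x - e / 2) 0.
    near=> y; apply: lt_le_trans (profile_ge0 y); lra.
  have {le}s0 : 0 < profile x - e / 2 by rewrite lt_neqAle eq_sym s0.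
  have sm : 0 < profile x - e / 2 <= m.
    by rewrite s0/=; have := profile_le x; lra.
  have u0 : 0 < profile x by lra.
  have : `|x| < tau (profile x - e / 2).
    by rewrite -tau_profile//; apply: tau_decr => //; [lra|exact: profile_le].
  move=> /(cvgr_lt _ (@norm_continuous _ _ x)).
  apply: filterS => y /ltW; rewrite -profile_ge// => h.
  by apply: lt_le_trans h; lra.
near=> y; rewrite ltr_distlC; apply/andP; split; near: y => //.
Unshelve. all: by end_near. Qed.

Lemma profile_cvg0 : profile x @[x --> +oo] --> 0.
Proof.
apply/cvgrPdist_lt => e e0; near=> x.
rewrite sub0r normrN ger0_norm ?profile_ge0//.
have [me|em] := ltP m e; first exact: le_lt_trans (profile_le x) me.
rewrite ltNge profile_ge ?e0// -ltNge.
apply: lt_le_trans (ler_norm x); near: x; apply: nbhs_pinfty_gt; exact: num_real.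
Unshelve. all: by end_near. Qed.

(** For [x > 0] this is the derivative of the inverse of [tau]; evenness transports it to [x < 0]
    and produces the sign. *)
Lemma is_derive_profile x : x != 0 -> 0 < profile x ->
  is_derive x 1 profile (- Num.sg x * (g (profile x))^-1).
Proof.
move=> x0 u0.
have pos y : 0 < y -> 0 < profile y -> is_derive y 1 profile (- (g (profile y))^-1).
  move=> y0 uy0.
  have um : 0 < profile y < m by rewrite uy0 profile_ltm// gt_eqF.
  have [_ um'] := andP um.
  have := @is_derive_inverse R tau profile _ (profile y) _ _ (tau_d um).
  rewrite tau_profile// gtr0_norm// -invrN; apply.
  - near=> s; have /andP[s0 sm] : 0 < s < m.
      apply/andP; split; near: s; [exact: lt_nbhsr|exact: lt_nbhsl].
    apply: profile_tau; first by rewrite s0 ltW.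
    by rewrite gtr0_norm// -tau_m tau_decr.
  - near=> s; apply: tau_cont; apply/andP.
    by split; near: s; [exact: lt_nbhsr|exact: lt_nbhsl].
  - by rewrite oppr_eq0 gt_eqF// g_gt0.
have [xlt|xgt|/eqP] := ltgtP x 0; last by rewrite (negbTE x0).
- rewrite ltr0_sg// opprK mul1r.
  have nx : 0 < - x by rewrite oppr_gt0.
  have := pos (- x) nx; rewrite profileN => /(_ u0) d.
  have := is_derive1_comp d (is_deriveN (is_derive_id x 1)).
  rewrite mulrN1 opprK (_ : profile \o -%R = profile)//.
  by apply/funext => y /=; rewrite profileN.
- by rewrite gtr0_sg// mulN1r; exact: pos.
Unshelve. all: by end_near. Qed.

(* If the time map is bounded, the profile has compact support and the
   endpoints of the support are exceptional too. *)
Lemma profile_exceptional : exists s : seq R, forall x,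
  x \notin s -> x != 0 /\
    (0 < profile x < m \/ \forall y \near x, profile y = 0).
Proof.
have [[x1 u1]|nz] := pselect (exists x, profile x = 0); last first.
  exists [:: 0].
  move=> x; rewrite inE => x0; split=> //; left; rewrite profile_ltm// andbT.
  by rewrite lt_neqAle profile_ge0 andbT eq_sym; apply/eqP => ux; apply: nz; exists x.
pose Z := [set y | 0 <= y /\ profile y = 0].
have Zinf : has_inf Z.
  split; last by exists 0 => y [].
  by exists `|x1|; split=> //; rewrite profile_norm.
pose T := inf Z.
exists [:: 0; T; - T].
move=> x; rewrite !inE !negb_or => /and3P[x0 xT xNT]; split=> //.
have [xlt|xgt|xeq] := ltgtP `|x| T.
- left; rewrite profile_ltm// andbT lt_neqAle profile_ge0 andbT eq_sym.
  apply/eqP => ux; move: xlt; rewrite ltNge => /negP; apply.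
  apply: ge_inf; first by case: Zinf.
  by split=> //; rewrite profile_norm.
- right; near=> y.
  have yT : T < `|y|.
    near: y; apply: (cvgr_gt _ (@norm_continuous _ _ x)); exact: xgt.
  have [z [z0 uz] zy] : exists2 z, Z z & z < `|y|.
    have [|z Zz] := @inf_adherent _ Z (`|y| - T) _ Zinf; first by rewrite subr_gt0.
    by rewrite -/T subrKC => zy; exists z.
  apply/eqP; rewrite eq_le profile_ge0 andbT leNgt; apply/negP => uy.
  have : profile y <= profile z.
    rewrite profile_ge ?uy ?profile_le// (ger0_norm z0) tau_profile//.
    exact: ltW.
  by rewrite uz leNgt uy.
- have := xT; have := xNT.
  have [x00|x00] := leP 0 x.
    by rewrite -xeq ger0_norm// eqxx.
  by rewrite -xeq ltr0_norm// opprK eqxx.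
Unshelve. all: by end_near. Qed.

End time_map.

Lemma itvoo_integrable (R : realType) (f : R -> R) (a b I : R) :
  {in `]a, b[, continuous f} -> (forall x, x \in `]a, b[ -> 0 <= f x) ->
  (\int[lebesgue_measure]_(x in `]a, b[) (f x)%:E <= I%:E)%E ->
  lebesgue_measure.-integrable `[a, b] (EFin \o f).
Proof.
move=> cf f0 fI.
have mf : measurable_fun `]a, b[ f.
  by apply: open_continuous_measurable_fun => // x /set_mem; exact: cf.
have ioo : lebesgue_measure.-integrable `]a, b[ (EFin \o f).
  apply/integrableP; split; first exact/measurable_EFinP.
  apply: (@le_lt_trans _ _ I%:E); last by rewrite ltry.
  apply: le_trans fI; rewrite le_eqVlt; apply/orP; left; apply/eqP.
  by apply: eq_integral => x /set_mem xab /=; rewrite ger0_norm ?f0.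
have mfcc : measurable_fun `[a, b] (EFin \o f).
  by apply/measurable_EFinP; exact: (measurable_fun_itv_cc mf).
apply/integrableP; split=> //.
rewrite integral_itv_bndoo; first by have /integrableP[] := ioo.
by apply: measurableT_comp => //; apply/measurable_EFinP.
Qed.

(** The integral of [f] may diverge at 0, as a time map does for a profile that never vanishes. So
    [tau] is written locally as a difference of integrals based at some [e > 0], to which the
    fundamental theorem applies. *)
Lemma tail_primitive (R : realType) (f : R -> R) (m : R) :
  {in `]0, m[, continuous f} ->
  (forall e, 0 < e < m -> lebesgue_measure.-integrable `[e, m] (EFin \o f)) ->
  0 < m ->
  let tau s := (\int[lebesgue_measure]_(t in `]s, m]) f t)%R in
  [/\ tau m = 0, tau s @[s --> m^'-] --> 0
    & forall s, 0 < s < m -> is_derive s 1 tau (- f s)].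
Proof.
move=> cf intf m0 tau.
have tauE e s : 0 < e < m -> e <= s <= m ->
    tau s = (\int[lebesgue_measure]_(t in `[e, m]) f t -
             \int[lebesgue_measure]_(t in `[e, s]) f t)%R.
  move=> em /andP[es sm].
  by rewrite (Rintegral_itvB (intf _ em)) ?bnd_simp.
have taum : tau m = 0 by rewrite /tau set_itvoc0 ?Rintegral_set0.
split=> //.
  have e0 : 0 < m / 2 < m by lra.
  have /andP[_ em] := e0.
  have /(continuous_within_itvP _ em)[_ _ cm] :=
    parameterized_integral_continuous (ltW em) (intf _ e0).
  rewrite -taum (tauE _ _ e0) ?lexx ?ltW//.
  apply: (@cvg_trans _ ((fun s => \int[lebesgue_measure]_(t in `[m / 2, m]) f t -
             \int[lebesgue_measure]_(t in `[m / 2, s]) f t)%R @ m^'-)); last first.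
    by apply: cvgB; [exact: cvg_cst|exact: cm].
  apply: near_eq_cvg; near=> s; apply/esym/(tauE _ _ e0); apply/andP; split.
    by near: s; exact: nbhs_left_ge.
  by near: s; exact: nbhs_left_le.
move=> s /andP[s0 sm]; have e0 : 0 < s / 2 < m by lra.
have es : s / 2 < s by lra.
have cfs : {for s, continuous f} by apply: cf; rewrite in_itv/= s0.
have [dF F'] := continuous_FTC1_closed sm (intf _ e0) es cfs.
have dN : is_derive s 1 (fun x => \int[lebesgue_measure]_(t in `[s / 2, x]) f t)%R (f s).
  by apply: DeriveDef; [exact: dF|rewrite -derive1E; exact: F'].
have := is_deriveB (is_derive_cst (\int[lebesgue_measure]_(t in `[s / 2, m]) f t)%R s 1) dN.
rewrite sub0r; apply: near_eq_is_derive; near=> t.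
apply/esym/(tauE _ _ e0); apply/andP; split.
  by apply: ltW; near: t; exact: lt_nbhsr.
by apply: ltW; near: t; exact: lt_nbhsl.
Unshelve. all: by end_near. Qed.

(** Meant for the mass density, which unlike the time density is integrable up to 0, so that the
    primitive can start there. *)
Lemma head_primitive (R : realType) (f : R -> R) (m I : R) :
  {in `]0, m[, continuous f} -> (forall x, x \in `]0, m[ -> 0 <= f x) ->
  (\int[lebesgue_measure]_(x in `]0%R, m[) (f x)%:E = I%:E)%E -> 0 < m ->
  let N s := (\int[lebesgue_measure]_(t in `[0, s]) f t)%R in
  [/\ N 0 = 0, N m = I, {within `[0, m], continuous N}
    & forall s, 0 < s < m -> is_derive s 1 N (f s)].
Proof.
move=> cf f0 fI m0 N.
have intf : lebesgue_measure.-integrable `[0, m] (EFin \o f).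
  by apply: (@itvoo_integrable _ _ _ _ I) => //; rewrite fI.
split.
- by rewrite /N set_itv1 Rintegral_set1.
- rewrite /N /Rintegral integral_itv_bndoo; first by rewrite fI.
  apply/measurable_EFinP; apply: open_continuous_measurable_fun => //.
  by move=> x /set_mem; exact: cf.
- exact: parameterized_integral_continuous (ltW m0) intf.
- move=> s /andP[s0 sm].
  have cfs : {for s, continuous f} by apply: cf; rewrite in_itv/= s0.
  have [dF F'] := continuous_FTC1_closed sm intf s0 cfs.
  by apply: DeriveDef; [exact: dF|rewrite -derive1E; exact: F'].
Qed.

(** * The solution of u'' = h(u) with energy u'^2 / 2 = H(u) *)

Section homoclinic.
Variables (R : realType) (H h : R -> R) (q m I : R).
Hypothesis q_gt0 : 0 < q.
Hypothesis m_gt0 : 0 < m.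
Hypothesis cH : {within `[0, m], continuous H}.
Hypothesis ch : {within `[0, m], continuous h}.
Hypothesis H0 : H 0 = 0.
Hypothesis Hm : H m = 0.
Hypothesis h0 : h 0 = 0.
Hypothesis H_gt0 : forall s, 0 < s < m -> 0 < H s.
Hypothesis dH : forall s, 0 < s < m -> is_derive s 1 H (h s).
Hypothesis massI : (\int[lebesgue_measure]_(s in `]0%R, m[)
  (s `^ q / Num.sqrt (2 * H s))%:E = I%:E)%E.

Let g s := (Num.sqrt (2 * H s))^-1.

Let g_gt0 s : 0 < s < m -> 0 < g s.
Proof. by move=> /H_gt0 Hs; rewrite invr_gt0 sqrtr_gt0 mulr_gt0. Qed.

Let cg : {in `]0, m[, continuous g}.
Proof.
move=> s; rewrite in_itv/= => sm.
have cHs : {for s, continuous H}.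
  by have [dHs _] := dH sm; exact/differentiable_continuous/derivable1_diffP.
apply: cvgV; first by rewrite gt_eqF// sqrtr_gt0 mulr_gt0// H_gt0.
apply: (@continuous_comp _ _ _ (fun s => 2 * H s) Num.sqrt); last exact: sqrt_continuous.
by apply: cvgM; [exact: cvg_cst|exact: cHs].
Qed.

Let mass_cont : {in `]0, m[, continuous (fun s => s `^ q * g s)}.
Proof.
move=> s sm; apply: cvgM; last exact: cg.
by apply: continuous_powR_gt0; move: sm; rewrite in_itv/= => /andP[].
Qed.

Let mass_ge0 s : s \in `]0, m[ -> 0 <= s `^ q * g s.
Proof. by rewrite in_itv/= => sm; rewrite mulr_ge0 ?powR_ge0// ltW ?g_gt0. Qed.

Let g_int e : 0 < e < m -> lebesgue_measure.-integrable `[e, m] (EFin \o g).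
Proof.
move=> /andP[e0 em].
have sub s : s \in `]e, m[ -> 0 < s < m.
  by rewrite in_itv/= => /andP[es ->]; rewrite (lt_trans e0).
have sub' : `]e, m[ `<=` `]0, m[.
  by move=> s /= /sub; rewrite in_itv.
have mq : measurable_fun `]0, m[ (fun s => s `^ q * g s).
  by apply: open_continuous_measurable_fun => // x /set_mem; exact: mass_cont.
have mg : measurable_fun `]0, m[ g.
  by apply: open_continuous_measurable_fun => // x /set_mem; exact: cg.
apply: (@itvoo_integrable _ _ _ _ (e `^ (- q) * I)).
- by move=> s /sub sm; apply: cg; rewrite in_itv.
- by move=> s /sub /g_gt0 /ltW.
rewrite EFinM -massI -ge0_integralZl_EFin//; last 2 first.
- exact/measurable_EFinP.
- exact: powR_ge0.
apply: (@le_trans _ _ (\int[lebesgue_measure]_(s in `]e, m[)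
    ((e `^ (- q))%:E * (s `^ q * g s)%:E)))%E.
  apply: ge0_le_integral => //.
  - by move=> s /sub /g_gt0 /ltW; rewrite lee_fin.
  - by apply/measurable_EFinP; exact: measurable_funS mg.
  - apply/measurable_EFinP; apply: measurable_funM => //.
    exact: measurable_funS mq.
  - move=> s se; have /sub/g_gt0 gs := se; rewrite -EFinM lee_fin mulrA ler_peMl ?(ltW gs)//.
    rewrite powRN mulrC ler_pdivlMr ?powR_gt0// mul1r.
    move: se; rewrite /= in_itv/= => /andP[es _].
    by apply: ge0_ler_powR; rewrite ?nnegrE ?ltW// (lt_trans e0).
apply: ge0_subset_integral => //.
- by apply/measurable_EFinP; apply: measurable_funM.
- by move=> s sm; rewrite -EFinM lee_fin mulr_ge0 ?powR_ge0 ?mass_ge0.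
Qed.

Let tau s := (\int[lebesgue_measure]_(t in `]s, m]) g t)%R.
Let u : R -> R := profile m tau.

Let u_ge0 x : 0 <= u x. Proof. exact: profile_ge0. Qed.

Let u_cont : continuous u.
Proof.
by have [a b c] := tail_primitive cg g_int m_gt0; exact: (continuous_profile m_gt0 a b c g_gt0).
Qed.

Let u_at0 : u 0 = m.
Proof.
by have [a b c] := tail_primitive cg g_int m_gt0; exact: (profile0 m_gt0 a b c g_gt0).
Qed.

Let uN x : u (- x) = u x. Proof. exact: profileN. Qed.

Let u_cvg0 : u x @[x --> +oo] --> 0.
Proof.
by have [a b c] := tail_primitive cg g_int m_gt0; exact: (profile_cvg0 m_gt0 a b c g_gt0).
Qed.

Let u_in x : `[0, m]%classic (u x).
Proof. by rewrite /= in_itv/= u_ge0 profile_le. Qed.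

Let comp_cont (N : R -> R) : {within `[0, m], continuous N} ->
  continuous (fun x => N (u x)).
Proof.
by move=> cN x; apply: (cvg_within_comp _ cN) => //; exact: u_cont.
Qed.

Let u_off : exists s : seq R, forall x, x \notin s -> [/\ x != 0, \forall y \near x, Num.sg y = Num.sg x &
    (0 < u x < m /\ is_derive x 1 u (- Num.sg x * (g (u x))^-1))
    \/ \forall y \near x, u y = 0].
Proof.
have [a b c] := tail_primitive cg g_int m_gt0.
have [s sP] := profile_exceptional m_gt0 a b c g_gt0.
exists s => x /sP[x0 ux]; split=> //.
  have [x1|x1|/eqP] := ltgtP x 0; last by rewrite (negbTE x0).
    by near=> y; rewrite !ltr0_sg//; near: y; exact: lt_nbhsl.
  by near=> y; rewrite !gtr0_sg//; near: y; exact: lt_nbhsr.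
case: ux => [ux|ux]; [left|by right].
split=> //; apply: (is_derive_profile m_gt0 a b c g_gt0 x0).
by case/andP: ux.
Unshelve. all: by end_near. Qed.

(** The energy identity makes [w] the speed of the profile; the sign in [v] makes it rise before 0
    and fall after. *)
Let w x := Num.sqrt (2 * H (u x)).
Let v x := - (Num.sg x * w x).

Let w_cont : continuous w.
Proof.
move=> x; apply: (@continuous_comp R R R (fun x => 2 * H (u x)) Num.sqrt); last exact: sqrt_continuous.
by apply: cvgM; [exact: cvg_cst|exact: comp_cont].
Qed.

Let v_cont : continuous v.
Proof.
move=> x; apply: cvgN; apply: continuous_sgrM => //.
by rewrite /w u_at0 Hm mulr0 sqrtr0.
Qed.

Let gw x : (g (u x))^-1 = w x. Proof. by rewrite /g invrK. Qed.

Let w_gt0 x : 0 < u x < m -> 0 < w x.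
Proof. by move=> /H_gt0 Hu; rewrite sqrtr_gt0 mulr_gt0. Qed.

Let w_u0 x : u x = 0 -> w x = 0.
Proof. by move=> ux; rewrite /w ux H0 mulr0 sqrtr0. Qed.

Let u_d (x : R) : is_derive x 1 u (v x).
Proof.
move: x; have [s sP] := u_off; apply: (@is_derive1_off_seq _ _ _ s) => //.
move=> x /sP[x0 _ [[ux d]|ux]]; first by move: d; rewrite gw mulNr.
rewrite /v w_u0; last exact: (nbhs_singleton ux).
rewrite mulr0 oppr0; apply: (near_eq_is_derive _ (is_derive_cst 0 x 1)).
by near=> y; apply/esym; near: y; exact: ux.
Unshelve. all: by end_near. Qed.

(** Where [0 < u x < m], differentiating the square root gives [h (u x) * v x / w x], and the two
    signs multiply to 1. Where [u] vanishes locally, [v] does too and [h 0 = 0] matches. The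
    remaining points follow from continuity of [h] along [u]. *)
Let v_d (x : R) : is_derive x 1 v (h (u x)).
Proof.
move: x; have [s sP] := u_off; apply: (@is_derive1_off_seq _ _ _ s) => //.
  exact: comp_cont.
move=> x /sP[x0 sg_x [[ux _]|ux]]; last first.
  rewrite (nbhs_singleton ux) h0; apply: (near_eq_is_derive _ (is_derive_cst 0 x 1)).
  near=> y; rewrite /v w_u0 ?mulr0 ?oppr0//.
  by near: y; exact: ux.
have dHu := @is_derive1_comp _ H u _ _ _ (dH ux) (u_d x).
have Hx : 0 < 2 * H (u x) by rewrite mulr_gt0 ?H_gt0.
have dw := @is_derive1_comp _ Num.sqrt (2 \*: (H \o u)) x _ _ (is_derive1_sqrt Hx) (is_deriveZ 2 dHu).
have dv := is_deriveN (is_deriveZ (Num.sg x) dw).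
have E : \forall y \near x, (- (Num.sg x \*: (Num.sqrt \o (2 \*: (H \o u))))) y = v y.
  near=> y; rewrite /v (_ : Num.sg y = Num.sg x)//.
  by near: y; exact: sg_x.
apply: (is_derive_eq (near_eq_is_derive E dv)).
rewrite -/(w x) /v /GRing.scale/=.
have wx := w_gt0 ux.
have sx : Num.sg x * Num.sg x = 1 by rewrite -expr2 sqr_sg x0.
have -> : - (Num.sg x * ((2 * w x)^-1 * (2 * (h (u x) * - (Num.sg x * w x))))) =
  (Num.sg x * Num.sg x) * (h (u x) * ((2 * w x)^-1 * (2 * w x))) by ring.
by rewrite sx mul1r mulVf ?mulr1// mulf_neq0// gt_eqF.
Unshelve. all: by end_near. Qed.

Let uq x := u x `^ q.

Let uq_cont : continuous uq.
Proof.
rewrite (_ : uq = fun x => `|u x| `^ q); last by apply/funext => x; rewrite ger0_norm.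
move=> x; apply: (@continuous_comp R R R u (fun s : R => `|s| `^ q)); first exact: u_cont.
exact: continuous_powR_norm.
Qed.

Let N s := (\int[lebesgue_measure]_(t in `[0, s]) (t `^ q * g t))%R.
(** The primitive of [u]^ q[vanishing at 0. For]x > 0[, changing variables to the level]s = u
    y[gives the mass over][0, x][as the integral of]s [^ q * g s] from [u x] to [m]. *)
Let psi x := Num.sg x * (I - N (u x)).

Let NP : [/\ N 0 = 0, N m = I, {within `[0, m], continuous N}
    & forall s, 0 < s < m -> is_derive s 1 N (s `^ q * g s)].
Proof. exact: (head_primitive mass_cont mass_ge0 massI m_gt0). Qed.

Let psi_d (x : R) : is_derive x 1 psi (uq x).
Proof.
have [N0 Nm cN dN] := NP.
move: x; have [s sP] := u_off; apply: (@is_derive1_off_seq _ _ _ s) => //.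
  apply: continuous_sgrM; last by rewrite u_at0 Nm subrr.
  by move=> x; apply: cvgB; [exact: cvg_cst|exact: comp_cont].
move=> x /sP[x0 sg_x [[ux _]|ux]]; last first.
  rewrite /uq (nbhs_singleton ux) powR0 ?gt_eqF//.
  apply: (near_eq_is_derive _ (is_derive_cst (Num.sg x * I) x 1)).
  near=> y; rewrite /psi (_ : u y = 0) ?N0 ?subr0; last by near: y; exact: ux.
  by rewrite (_ : Num.sg y = Num.sg x)//; near: y; exact: sg_x.
have dNu := @is_derive1_comp _ N u _ _ _ (dN _ ux) (u_d x).
have dp := is_deriveZ (Num.sg x) (is_deriveB (is_derive_cst I x 1) dNu).
have E : \forall y \near x, (Num.sg x \*: (cst I - (N \o u))) y = psi y.
  near=> y; rewrite /psi (_ : Num.sg y = Num.sg x)//.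
  by near: y; exact: sg_x.
apply: (is_derive_eq (near_eq_is_derive E dp)).
rewrite -/(uq x) sub0r /v -gw /GRing.scale/=.
have gx := g_gt0 ux.
have sx : Num.sg x * Num.sg x = 1 by rewrite -expr2 sqr_sg x0.
have -> : Num.sg x * - (uq x * g (u x) * - (Num.sg x / g (u x))) =
  (Num.sg x * Num.sg x) * (uq x * (g (u x) / g (u x))) by ring.
by rewrite sx mul1r divff ?mulr1// gt_eqF.
Unshelve. all: by end_near. Qed.

(** At infinity [u] tends to 0, hence [psi] tends to [I]; the factor 2 counts the two halves of an
    even function. *)
Let mass_u : (\int[lebesgue_measure]_x (u x `^ q)%:E = (2 * I)%:E)%E.
Proof.
have [N0 Nm cN dN] := NP.
rewrite (@ge0_symfun_integralT _ uq)//; last 2 first.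
- by move=> x; exact: powR_ge0.
- by move=> x; rewrite /uq /= uN.
rewrite -set_itvcy (@ge0_continuous_FTC2y _ uq psi 0 I); last 6 first.
- by move=> x _; exact: powR_ge0.
- exact: continuous_subspaceT.
- have : (I - N (u x)) @[x --> +oo] --> I - N 0.
    apply: cvgB; first exact: cvg_cst.
    by apply: (cvg_within_comp _ cN) => //; rewrite /= in_itv/= lexx ltW.
  rewrite N0 subr0; apply: cvg_trans; apply: near_eq_cvg; near=> x.
  by rewrite /psi gtr0_sg ?mul1r//; near: x; exact: nbhs_pinfty_gt.
- by move=> x _; have [] := psi_d x.
- apply: cvg_at_right_filter; apply/differentiable_continuous/derivable1_diffP.
  by have [] := psi_d 0.
- by move=> x _; rewrite derive1E; have [_ ->] := psi_d x.
by rewrite /psi sgr0 mul0r sube0 EFinM.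
Unshelve. all: by end_near. Qed.

Let mw : measurable_fun [set: R] w.
Proof. exact: continuous_measurable_fun. Qed.

Let int_w : (\int[lebesgue_measure]_(x in `[0%R, +oo[) (w x)%:E = m%:E)%E.
Proof.
rewrite (@ge0_continuous_FTC2y _ w (- u) 0 0); last 6 first.
- by move=> x _; exact: sqrtr_ge0.
- exact: continuous_subspaceT.
- by rewrite -oppr0; exact: cvgN.
- by move=> x _; have [] := is_deriveN (u_d x).
- apply: cvg_at_right_filter; apply: cvgN; exact: u_cont.
- move=> x; rewrite in_itv/= andbT => x0.
  rewrite derive1E; have [_ ->] := is_deriveN (u_d x).
  by rewrite /v gtr0_sg// mul1r opprK.
by rewrite sub0e -EFinN /= opprK u_at0.
Qed.

(** The speed is bounded by some [C], since [H] attains a maximum on [[0, m]], and its integral over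
    a half line is the total drop [m]. So the square of [v], being at most [C * w], is
    integrable. *)
Let v_L2 : v \in Lfun lebesgue_measure 2%:E.
Proof.
have [c _ HC] := EVT_max (ltW m_gt0) cH.
have wC t : t \in `[0, m] -> Num.sqrt (2 * H t) <= Num.sqrt (2 * H c).
  by move=> tm; rewrite ler_wsqrtr// ler_pM2l// HC.
pose C := Num.sqrt (2 * H c).
have wv x : `|v x| ^+ 2 <= C * w x.
  rewrite normrN normrM (ger0_norm (sqrtr_ge0 _)) exprMn.
  rewrite -[leRHS]mul1r ler_pM ?exprn_ge0 ?sqrtr_ge0//.
    by rewrite expr_le1// normr_sg; case: (x != 0).
  by rewrite expr2 ler_wpM2r ?sqrtr_ge0// wC// (u_in x).
rewrite inE/=; apply/andP; split; rewrite inE/=.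
  exact: continuous_measurable_fun.
rewrite /finite_norm unlock poweR_lty//.
apply: (@le_lt_trans _ _ (\int[lebesgue_measure]_x (C * w x)%:E)%E).
  apply: ge0_le_integral => //.
  - move=> x _; exact: poweR_ge0.
  - apply/measurable_EFinP; apply: continuous_measurable_fun.
    move=> x; apply: (@continuous_comp R R R v (fun s : R => `|s| `^ 2)); first exact: v_cont.
    exact: continuous_powR_norm.
  - by apply/measurable_EFinP; apply: measurable_funM.
  - move=> x _; rewrite /= lee_fin powR_mulrn//.
rewrite ge0_symfun_integralT; last 3 first.
- by move=> x; rewrite mulr_ge0 ?sqrtr_ge0.
- by move=> x; apply: cvgM; [exact: cvg_cst|exact: w_cont].
- by move=> x /=; rewrite /w uN.
rewrite -set_itvcy.
under eq_integral do rewrite EFinM.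
rewrite ge0_integralZl_EFin ?int_w ?sqrtr_ge0//.
- by rewrite -!EFinM ltry.
- by move=> x _; rewrite lee_fin sqrtr_ge0.
- by apply/measurable_EFinP; exact: measurable_funS mw.
Qed.

Theorem homoclinic_profile : exists u : R -> R,
  [/\ C2 u, forall x, (u^`(2))%classic x = h (u x) &
      (\int[lebesgue_measure]_x (u x `^ q)%:E = (2 * I)%:E)%E] /\
  [/\ (u^`())%classic \in Lfun lebesgue_measure 2%:E,
      forall x, 0 <= u x <= m, forall x, u (- x) = u x,
      u x @[x --> +oo] --> 0 & u x @[x --> -oo] --> 0].
Proof.
have uE : (u^`())%classic = v.
  by apply/funext => x; rewrite derive1E; have [_ ->] := u_d x.
have uE2 : (u^`(2))%classic = (fun x => h (u x)).
  by apply/funext => x; rewrite derive1nS derive1n1 uE derive1E; have [_ ->] := v_d x.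
exists u; split; split => //.
- split; [by move=> x; have [] := u_d x|rewrite uE => x; by have [] := v_d x|].
  by rewrite uE2; exact: comp_cont.
- by rewrite uE2.
- by rewrite uE.
rewrite (_ : u = u \o -%R); last by apply/funext => x; rewrite /= uN.
by apply/cvgy_compNP; exact: u_cvg0.
Qed.

End homoclinic.

(** * The mass as a function of the maximum *)

Lemma ler_sqrtV2 (R : realType) (x y : R) : 0 < x -> x <= y ->
  (Num.sqrt y)^-1 <= (Num.sqrt x)^-1.
Proof.
move=> x0 xy; have y0 := lt_le_trans x0 xy.
by rewrite lef_pV2 ?posrE ?sqrtr_gt0// ler_wsqrtr.
Qed.

Lemma ler_sqrtV_sqrt (R : realType) (c D X : R) : 0 < D -> 0 < X -> D <= c * X ->
  (Num.sqrt X)^-1 <= Num.sqrt c / Num.sqrt D.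
Proof.
move=> D0 X0 DX; have c0 : 0 < c by rewrite -(pmulr_lgt0 _ X0) (lt_le_trans D0).
rewrite ler_pdivlMr ?sqrtr_gt0// mulrC ler_pdivrMr ?sqrtr_gt0//.
by rewrite -sqrtrM ?ler_wsqrtr// ltW.
Qed.

Lemma ler_sqrt_sqrtV (R : realType) (c D X : R) : 0 < D -> 0 < X -> 0 <= c ->
  c * X <= D -> Num.sqrt c / Num.sqrt D <= (Num.sqrt X)^-1.
Proof.
move=> D0 X0 c0 DX.
rewrite ler_pdivrMr ?sqrtr_gt0// mulrC ler_pdivlMr ?sqrtr_gt0//.
by rewrite -sqrtrM ?ler_wsqrtr.
Qed.

Section mass.
Variables (R : realType) (G G' : R -> R) (a m0 : R).
Hypothesis a_gt0 : 0 < a.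
Hypothesis m0_ge0 : 0 <= m0.
Hypothesis dG : forall s : R, 0 < s -> is_derive s 1 G (G' s).
Hypothesis cG' : forall s, 0 < s -> {for s, continuous G'}.
Hypothesis G'_gt0 : forall s, m0 < s -> 0 < G' s.
Hypothesis G_le0 : forall s, 0 < s <= m0 -> G s <= 0.
Hypothesis G_gt0 : forall s, m0 < s -> 0 < G s.

Let cG s : 0 < s -> {for s, continuous G}.
Proof.
by move=> /dG[d _]; exact/differentiable_continuous/derivable1_diffP.
Qed.

(* Mean value theorem for [G t - k / (2 * a) * t `^ (2 * a)]. *)
Let G_mvt k s m : 0 < s -> s < m -> exists2 c, s < c < m &
  G m - G s - k * (m `^ (2 * a) - s `^ (2 * a)) / (2 * a) =
  (G' c - k * c `^ (2 * a - 1)) * (m - s).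
Proof.
move=> s0 sm.
pose psi t := G t - k / (2 * a) * t `^ (2 * a).
have dpsi (t : R) : 0 < t -> is_derive t 1 psi (G' t - k * t `^ (2 * a - 1)).
  move=> t0.
  have dk := is_deriveB (dG t0) (is_deriveZ (k / (2 * a)) (is_derive1_powR (2 * a) t0)).
  apply: (is_derive_eq dk); rewrite /GRing.scale/=; congr (_ - _).
  by rewrite mulrA divfK// gt_eqF// mulr_gt0.
have [||c /[!in_itv]/= scm E] := @MVT R psi (fun t => G' t - k * t `^ (2 * a - 1)) s m sm.
- by move=> t; rewrite in_itv/= => /andP[st _]; apply: dpsi; exact: lt_trans st.
- apply: derivable_within_continuous => t; rewrite in_itv/= => /andP[st _].
  by have [] := dpsi t (lt_le_trans s0 st).
exists c => //; rewrite -E /psi; field.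
by rewrite gt_eqF.
Qed.

(** [G] need not be monotone up to [m0]: there the signs of [G s] and [G m] decide, and beyond [m0]
    the positive derivative does. *)
Lemma pot_lt s m : 0 < s -> s < m -> m0 < m -> G s < G m.
Proof.
move=> s0 sm m0m; have [sm0|m0s] := leP s m0.
  by apply: (@le_lt_trans _ _ 0); [apply: G_le0; rewrite s0|exact: G_gt0].
have [c /andP[sc _]] := G_mvt 0 s0 sm.
rewrite !mul0r !subr0 => E; rewrite -subr_gt0 E mulr_gt0 ?subr_gt0//.
by apply: G'_gt0; exact: lt_trans sc.
Qed.

Definition mass_density m s : R := s `^ (a - 1) / Num.sqrt (G m - G s).

Let dens_cont m : m0 < m -> {in `]0, m[, continuous (mass_density m)}.
Proof.
move=> m0m s; rewrite in_itv/= => /andP[s0 sm].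
apply: cvgM; first exact: continuous_powR_gt0.
apply: cvgV; first by rewrite gt_eqF// sqrtr_gt0 subr_gt0 pot_lt.
apply: (@continuous_comp _ _ _ (fun s => G m - G s) Num.sqrt); last exact: sqrt_continuous.
by apply: cvgB; [exact: cvg_cst|exact: cG].
Qed.

Let dens_ge0 m s : 0 <= mass_density m s.
Proof. by rewrite divr_ge0 ?powR_ge0 ?sqrtr_ge0. Qed.

Let dens_meas m S T : m0 < m -> 0 <= S -> T <= m ->
  measurable_fun `]S, T[ (mass_density m).
Proof.
move=> m0m S0 Tm.
have : measurable_fun `]0, m[ (mass_density m).
  by apply: open_continuous_measurable_fun => // x /set_mem; exact: dens_cont.
apply: measurable_funS => // x /=; rewrite !in_itv/= => /andP[Sx xT].
by rewrite (le_lt_trans S0)//= (lt_le_trans xT).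
Qed.

Definition mass_between m S T : \bar R :=
  (\int[lebesgue_measure]_(s in `]S, T[) (mass_density m s)%:E)%E.

Let mass_between_ge0 m S T : (0 <= mass_between m S T)%E.
Proof. by apply: integral_ge0 => s _; rewrite lee_fin. Qed.

Lemma mass_between_split m S : m0 < m -> 0 < S < m ->
  (mass_between m 0%R m = mass_between m 0%R S + mass_between m S m)%E.
Proof.
move=> m0m /andP[S0 Sm]; rewrite /mass_between.
rewrite -(@integral_itv_bndoo _ S m _ true true); last first.
  by apply/measurable_EFinP; apply: dens_meas => //; exact: ltW.
rewrite -ge0_integral_setU//.
- by rewrite -itv_bndbnd_setU// bnd_simp// ltW.
- rewrite -itv_bndbnd_setU ?bnd_simp// ?ltW//.
  by apply/measurable_EFinP; exact: dens_meas.
- by move=> s _; rewrite lee_fin.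
- apply/disj_set2P; rewrite -subset0 => s /= []; rewrite !in_itv/= => /andP[_ sS] /andP[Ss _].
  by move: sS; rewrite ltNge Ss.
Qed.

Definition mass_arc S m : R :=
  2 / a * atan (Num.sqrt ((m `^ a - S `^ a) / (m `^ a + S `^ a))).

Let pow_meas (m S : R) : 0 <= S -> S < m -> measurable_fun `]S, m[
  (fun s : R => s `^ (a - 1) / Num.sqrt (m `^ (2 * a) - s `^ (2 * a))).
Proof.
move=> S0 Sm; apply: open_continuous_measurable_fun => // s /set_mem.
rewrite /= in_itv/= => /andP[Ss sm]; have s0 : 0 < s by exact: le_lt_trans Ss.
apply: cvgM; first exact: continuous_powR_gt0.
apply: cvgV.
  rewrite gt_eqF// sqrtr_gt0 subr_gt0 gt0_ltr_powR ?nnegrE ?mulr_gt0// ltW//.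
  exact: lt_trans sm.
apply: (@continuous_comp _ _ _ (fun s => m `^ (2 * a) - s `^ (2 * a)) Num.sqrt); last exact: sqrt_continuous.
by apply: cvgB; [exact: cvg_cst|exact: continuous_powR_gt0].
Qed.

(** The model case: G'(t) = k t^(2a-1) amounts to G(t) = k t^(2a) / (2a) up to a constant, whence
    the factor [Num.sqrt (2 * a / k)]. *)
Lemma mass_arc_integral m S k : 0 <= S < m -> 0 < k ->
  (\int[lebesgue_measure]_(s in `]S, m[)
    (Num.sqrt (2 * a / k) * (s `^ (a - 1) / Num.sqrt (m `^ (2 * a) - s `^ (2 * a))))%:E =
  (Num.sqrt (2 * a / k) * mass_arc S m)%:E)%E.
Proof.
move=> /andP[S0 Sm] k0.
under eq_integral do rewrite EFinM.
rewrite ge0_integralZl_EFin//.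
- by rewrite integral_arcsin_powR ?S0// -EFinM.
- by move=> s _; rewrite lee_fin divr_ge0 ?powR_ge0 ?sqrtr_ge0.
- by apply/measurable_EFinP; exact: pow_meas.
Qed.

Let itvS m S s : 0 <= S -> s \in `]S, m[ ->
  [/\ 0 < s, s < m, S < s & 0 < m `^ (2 * a) - s `^ (2 * a)].
Proof.
move=> S0; rewrite in_itv/= => /andP[Ss sm]; have s0 := le_lt_trans S0 Ss.
split=> //; rewrite subr_gt0 gt0_ltr_powR ?nnegrE ?mulr_gt0// ltW//.
exact: lt_trans sm.
Qed.

(** By [G_mvt], the bound on the derivative integrates to G(m) - G(s) >= k (m^(2a) - s^(2a)) / (2a),
    so the density is at most the model one. *)
Lemma mass_upper m S k : m0 < m -> 0 <= S < m -> 0 < k ->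
  (forall t, S < t < m -> k * t `^ (2 * a - 1) <= G' t) ->
  (mass_between m S m <= (Num.sqrt (2 * a / k) * mass_arc S m)%:E)%E.
Proof.
move=> m0m /andP[S0 Sm] k0 kG; rewrite -mass_arc_integral ?S0//.
apply: ge0_le_integral => //.
- by move=> s _; rewrite lee_fin.
- by apply/measurable_EFinP; exact: dens_meas.
- by apply/measurable_EFinP; apply: measurable_funM => //; exact: pow_meas.
- move=> s /(itvS S0)[s0 sm Ss pw]; rewrite lee_fin mulrCA ler_wpM2l ?powR_ge0//.
  have [c /andP[sc cm] E] := G_mvt k s0 sm.
  have h : 0 <= G m - G s - k * (m `^ (2 * a) - s `^ (2 * a)) / (2 * a).
    rewrite E mulr_ge0 ?subr_ge0 ?(ltW sm)//.
    by apply: kG; rewrite cm (lt_trans Ss).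
  apply: ler_sqrtV_sqrt => //; first by rewrite subr_gt0 pot_lt.
  rewrite (_ : m `^ (2 * a) - _ = 2 * a / k * (k * (m `^ (2 * a) - s `^ (2 * a)) / (2 * a))).
    by apply: ler_wpM2l; [rewrite divr_ge0 ?mulr_ge0 ?ltW|rewrite -subr_ge0].
  by field; rewrite !gt_eqF.
Qed.

Lemma mass_lower m S k : m0 < m -> 0 <= S < m -> 0 < k ->
  (forall t, S < t < m -> G' t <= k * t `^ (2 * a - 1)) ->
  ((Num.sqrt (2 * a / k) * mass_arc S m)%:E <= mass_between m S m)%E.
Proof.
move=> m0m /andP[S0 Sm] k0 kG; rewrite -mass_arc_integral ?S0//.
apply: ge0_le_integral => //.
- by move=> s _; rewrite lee_fin !mulr_ge0 ?invr_ge0 ?powR_ge0 ?sqrtr_ge0.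
- by apply/measurable_EFinP; apply: measurable_funM => //; exact: pow_meas.
- by apply/measurable_EFinP; exact: dens_meas.
- move=> s /(itvS S0)[s0 sm Ss pw]; rewrite lee_fin mulrCA ler_wpM2l ?powR_ge0//.
  have [c /andP[sc cm] E] := G_mvt k s0 sm.
  have h : G m - G s - k * (m `^ (2 * a) - s `^ (2 * a)) / (2 * a) <= 0.
    rewrite E mulr_le0_ge0 ?subr_ge0 ?(ltW sm)// subr_le0.
    by apply: kG; rewrite cm (lt_trans Ss).
  apply: ler_sqrt_sqrtV => //.
  + by rewrite subr_gt0 pot_lt.
  + by rewrite divr_ge0 ?mulr_ge0 ?ltW.
  rewrite [leRHS](_ : _ = 2 * a / k * (k * (m `^ (2 * a) - s `^ (2 * a)) / (2 * a))).
    by apply: ler_wpM2l; [rewrite divr_ge0 ?mulr_ge0 ?ltW|rewrite -subr_le0].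
  by field; rewrite !gt_eqF.
Qed.

(** Since [m0 < S], every [G s] with [s < S] lies below [G S]; the square root is bounded away from
    0 and [s]^ (a - 1)[integrates to]S [^ a / a]. *)
Lemma mass_head m S : m0 < S < m ->
  (mass_between m 0%R S <= (S `^ a / a / Num.sqrt (G m - G S))%:E)%E.
Proof.
move=> /andP[m0S Sm]; have S0 : 0 < S by exact: le_lt_trans m0S.
have m0m := lt_trans m0S Sm.
have pm : measurable_fun `]0, S[ (fun s : R => s `^ (a - 1)).
  apply: open_continuous_measurable_fun => // s /set_mem.
  by rewrite /= in_itv/= => /andP[s0 _]; exact: continuous_powR_gt0.
have intP : (\int[lebesgue_measure]_(s in `]0%R, S[) (s `^ (a - 1))%:E = (S `^ a / a)%:E)%E.
  pose Phi (s : R) : R := `|s| `^ a / a.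
  have cP : {within `[0, S], continuous Phi}.
    apply: continuous_subspaceT => s.
    by apply: cvgM; [exact: continuous_powR_norm|exact: cvg_cst].
  have dP s : s \in `]0, S[ -> is_derive s 1 Phi (s `^ (a - 1)).
    rewrite in_itv/= => /andP[s0 _].
    have E : \forall t \near s, (a^-1 \*: (@powR R ^~ a)) t = Phi t.
      near=> t; rewrite /Phi ger0_norm; first by rewrite /GRing.scale/= mulrC.
      by apply: ltW; near: t; exact: lt_nbhsr.
    apply: (is_derive_eq (near_eq_is_derive E (is_deriveZ a^-1 (is_derive1_powR a s0)))).
    by rewrite /GRing.scale/= mulKf// gt_eqF.
  rewrite -[RHS](_ : (Phi S - Phi 0)%:E = _); last first.
    by rewrite /Phi normr0 powR0 ?gt_eqF// mul0r subr0 gtr0_norm.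
  apply: (ge0_FTC2_oo S0 _ _ cP dP).
  - by move=> s _; exact: powR_ge0.
  - by move=> s; rewrite in_itv/= => /andP[s0 _]; exact: continuous_powR_gt0.
have -> : S `^ a / a / Num.sqrt (G m - G S) = (Num.sqrt (G m - G S))^-1 * (S `^ a / a).
  by rewrite mulrC.
rewrite EFinM -intP -ge0_integralZl_EFin//; last 2 first.
- by move=> s _; rewrite lee_fin powR_ge0.
- exact/measurable_EFinP.
apply: ge0_le_integral => //.
- by move=> s _; rewrite lee_fin.
- by apply/measurable_EFinP; apply: dens_meas => //; exact: ltW.
- by apply/measurable_EFinP; exact: measurable_funM.
- move=> s; rewrite /= in_itv/= => /andP[s0 sS].
  rewrite -EFinM lee_fin [leRHS]mulrC; apply: ler_wpM2l; first exact: powR_ge0.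
  by apply: ler_sqrtV2; rewrite ?subr_gt0 ?lerB// ?ltW// pot_lt.
Unshelve. all: by end_near. Qed.

(** Provides the constant needed by [mass_upper] at the singular endpoint: the ratio of [G'] to the
    power is continuous and positive at [m], hence stays above half its value. *)
Lemma near_lower m : 0 < m -> 0 < G' m -> exists k d, [/\ 0 < k, 0 < d &
  forall t, `|m - t| < d -> 0 < t /\ k * t `^ (2 * a - 1) <= G' t].
Proof.
move=> m_gt0 Gm.
pose r t := G' t / t `^ (2 * a - 1).
have rm : 0 < r m by rewrite divr_gt0 ?powR_gt0.
have cr : {for m, continuous r}.
  apply: cvgM; first exact: cG'.
  by apply: cvgV; [rewrite gt_eqF// powR_gt0|exact: continuous_powR_gt0].
have [] : \forall t \near m, 0 < t /\ r m / 2 < r t.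
  near=> t; split; near: t; first exact: lt_nbhsr.
  by apply: (cvgr_gt _ cr); lra.
move=> d /= d0 dP; exists (r m / 2), d; split=> //; first by rewrite divr_gt0.
move=> t /dP[t0 rt]; split=> //.
by rewrite -ler_pdivlMr ?powR_gt0// ltW.
Unshelve. all: by end_near. Qed.

Lemma mass_arc_cvg (T : Type) (F : set_system T) (FF : Filter F) (x y : T -> R)
    (x0 y0 : R) : 0 < x0 -> 0 < y0 -> x t @[t --> F] --> x0 -> y t @[t --> F] --> y0 ->
  mass_arc (x t) (y t) @[t --> F] --> mass_arc x0 y0.
Proof.
move=> x0_gt0 y0_gt0 cx cy.
have px : x t `^ a @[t --> F] --> x0 `^ a.
  exact: (cvg_comp _ _ cx (continuous_powR_gt0 x0_gt0)).
have py : y t `^ a @[t --> F] --> y0 `^ a.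
  exact: (cvg_comp _ _ cy (continuous_powR_gt0 y0_gt0)).
apply: cvgM; first exact: cvg_cst.
apply: (cvg_comp (fun t => Num.sqrt ((y t `^ a - x t `^ a) / (y t `^ a + x t `^ a))) (@atan R)); last exact: continuous_atan.
apply: (cvg_comp (fun t => (y t `^ a - x t `^ a) / (y t `^ a + x t `^ a)) Num.sqrt); last exact: sqrt_continuous.
apply: cvgM; first exact: cvgB.
by apply: cvgV; [rewrite gt_eqF// addr_gt0 ?powR_gt0|exact: cvgD].
Qed.

Lemma mass_arcxx m : mass_arc m m = 0.
Proof. by rewrite /mass_arc subrr mul0r sqrtr0 atan0 mulr0. Qed.

(** For fixed [S] the quotient under the root tends to 1, and (2 / a) atan 1 = pi / (2a), the value
    of the whole arc from 0. *)
Lemma mass_arc_cvgy S : mass_arc S m @[m --> +oo] --> pi / (2 * a).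
Proof.
have -> : pi / (2 * a) = 2 / a * atan (Num.sqrt (1 - 0)).
  by rewrite subr0 sqrtr1 atan1; field; rewrite gt_eqF.
apply: (@cvg_trans _ ((fun m => 2 / a * atan (Num.sqrt (1 - 2 * S `^ a / (m `^ a + S `^ a)))) @ +oo)).
  apply: near_eq_cvg; near=> m; rewrite /mass_arc; congr (_ * atan (Num.sqrt _)).
  have m1 : 0 < m by near: m; exact: nbhs_pinfty_gt.
  field; rewrite gt_eqF// ltr_wpDr ?powR_ge0// powR_gt0//.
apply: cvgM; first exact: cvg_cst.
apply: (cvg_comp (fun m => Num.sqrt (1 - 2 * S `^ a / (m `^ a + S `^ a))) (@atan R)); last exact: continuous_atan.
apply: (cvg_comp (fun m => 1 - 2 * S `^ a / (m `^ a + S `^ a)) Num.sqrt); last exact: sqrt_continuous.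
apply: cvgB; first exact: cvg_cst.
rewrite -(mulr0 (2 * S `^ a)); apply: cvgM; first exact: cvg_cst.
apply/cvgrPdist_lt => e e0; near=> m.
have m1 : 0 < m by near: m; exact: nbhs_pinfty_gt.
have den : 0 < m `^ a + S `^ a by rewrite ltr_wpDr ?powR_ge0// powR_gt0.
rewrite sub0r normrN gtr0_norm ?invr_gt0// invf_plt ?posrE//.
rewrite ltr_wpDr ?powR_ge0//.
rewrite -[ltLHS]powRr1 ?invr_ge0 ?(ltW e0)// -(mulVf (lt0r_neq0 a_gt0)) powRrM.
by rewrite gt0_ltr_powR ?nnegrE ?powR_ge0 ?(ltW m1).
Unshelve. all: by end_near. Qed.

Let fin_between m S T : (mass_between m S T < +oo)%E ->
  mass_between m S T = (fine (mass_between m S T))%:E.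
Proof. by move=> h; rewrite fineK// ge0_fin_numE. Qed.

Lemma mass_finite m : m0 < m -> (mass_between m 0%R m < +oo)%E.
Proof.
move=> m0m; have m_gt0 : 0 < m by exact: le_lt_trans m0m.
have [k [d [k0 d0 dP]]] := near_lower m_gt0 (G'_gt0 m0m).
(* A cut strictly between [m0] and [m] and within distance [d] of [m], so that both the head and the
   tail estimates apply. *)
pose S := (Num.max m0 (m - d) + m) / 2.
have mx : Num.max m0 (m - d) < m by rewrite gt_max m0m ltrBlDr ltrDl.
have [m0mx mdmx] : m0 <= Num.max m0 (m - d) /\ m - d <= Num.max m0 (m - d).
  by rewrite !le_max !lexx orbT.
have m0S : m0 < S by rewrite /S; lra.
have mdS : m - d < S by rewrite /S; lra.
have Sm : S < m by rewrite /S; lra.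
have S0 : 0 < S by exact: le_lt_trans m0S.
rewrite (mass_between_split m0m (S := S)) ?S0//; apply: lte_add_pinfty.
  by apply: le_lt_trans (mass_head (m := m) _) _; rewrite ?m0S ?ltry.
apply: le_lt_trans (mass_upper m0m _ k0 _) _; last by rewrite ltry.
  by rewrite ltW.
move=> t /andP[St tm]; apply: (dP t _).2.
by rewrite gtr0_norm ?subr_gt0//; lra.
Qed.

Let head_integrable m S : m0 < S < m ->
  lebesgue_measure.-integrable `]0, S[ (EFin \o mass_density m).
Proof.
move=> m0Sm; have /andP[m0S Sm] := m0Sm.
apply/integrableP; split.
  by apply/measurable_EFinP; apply: dens_meas => //; [exact: lt_trans Sm|exact: ltW].
apply: le_lt_trans (ltry (S `^ a / a / Num.sqrt (G m - G S))).
apply: le_trans (mass_head m0Sm); rewrite le_eqVlt; apply/orP; left; apply/eqP.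
by apply: eq_integral => s _ /=; rewrite ger0_norm.
Qed.

(** Dominated convergence: a larger maximum gives a smaller density, so all parameters beyond the
    midpoint of [S] and [m] are dominated by the density at that midpoint, which is integrable up to
    [S]. *)
Let head_continuous m S : m0 < S < m ->
  {for m, continuous (fun x => fine (mass_between x 0%R S))}.
Proof.
move=> /andP[m0S Sm]; have S0 : 0 < S by exact: le_lt_trans m0S.
have SS' : S < (S + m) / 2 by lra.
have S'm : (S + m) / 2 < m by lra.
have := @continuity_under_integral R _ _ lebesgue_measure mass_density `]0, S[
  (measurable_itv _) ((S + m) / 2) (m + 1).
move=> /(_ _ _ (mass_density ((S + m) / 2)) _ _ m); apply.
- move=> x; rewrite /= in_itv/= => /andP[S'x _]; apply: head_integrable.
  by rewrite m0S (lt_trans SS').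
- apply: aeW => s /=; rewrite in_itv/= => /andP[s0 sS] x /set_mem /=.
  rewrite in_itv/= => /andP[S'x _].
  have Sx := lt_trans SS' S'x.
  apply: cvgM; first exact: cvg_cst.
  apply: cvgV.
    by rewrite gt_eqF// sqrtr_gt0 subr_gt0 pot_lt// (lt_trans _ Sx).
  apply: (@continuous_comp _ _ _ (fun x => G x - G s) Num.sqrt); last exact: sqrt_continuous.
  by apply: cvgB; [apply: cG; exact: lt_trans Sx|exact: cvg_cst].
- by apply: head_integrable; rewrite m0S.
- move=> x /=; rewrite in_itv/= => /andP[S'x _].
  apply: aeW => s /=; rewrite in_itv/= => /andP[s0 sS].
  rewrite ger0_norm// ler_wpM2l ?powR_ge0//.
  have m0S' := lt_trans m0S SS'.
  have h1 : G s < G ((S + m) / 2) by apply: pot_lt => //; exact: lt_trans SS'.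
  have h2 : G ((S + m) / 2) < G x.
    by apply: pot_lt => //; [exact: lt_trans SS'|exact: lt_trans S'x].
  by apply: ler_sqrtV2; rewrite ?subr_gt0 ?lerB// ltW.
- by apply/mem_set; rewrite /= in_itv/= S'm ltrDl ltr01.
Qed.

Lemma mass_continuous m : m0 < m ->
  {for m, continuous (fun x => fine (mass_between x 0%R x))}.
Proof.
move=> m0m; have m_gt0 : 0 < m by exact: le_lt_trans m0m.
have [k [d [k0 d0 dP]]] := near_lower m_gt0 (G'_gt0 m0m).
apply/cvgrPdist_lt => e e0.
pose c := Num.sqrt (2 * a / k).
have arc0 : c * mass_arc S m @[S --> m] --> 0.
  rewrite -(mulr0 c) -(mass_arcxx m); apply: cvgM; first exact: cvg_cst.
  apply: (@mass_arc_cvg _ _ _ (fun x => x) (fun=> m)) => //; exact: cvg_cst.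
(* The error is split in thirds: one for the change of the head, one for each of the tails beyond
   [S]. The cut makes the tail bound small at [m], and [arcm] transfers this to nearby [x] with the
   same [S]. *)
have [S [m0S mdS Sm arcS]] : exists S, [/\ m0 < S, m - d < S, S < m & c * mass_arc S m < e / 3].
  near m^'- => S; exists S; split; near: S.
  - exact: nbhs_left_gt.
  - by apply: nbhs_left_gt; rewrite ltrBlDr ltrDl.
  - exact: nbhs_left_lt.
  - by apply: (cvgr_lt _ (cvg_at_left_filter arc0)); rewrite divr_gt0.
have S0 : 0 < S by exact: le_lt_trans m0S.
have split3 x : S < x -> x < m + d ->
    exists2 j2, fine (mass_between x 0%R x) = fine (mass_between x 0%R S) + j2 &
      0 <= j2 <= c * mass_arc S x.
  move=> Sx xmd; have m0x := lt_trans m0S Sx.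
  have up : (mass_between x S x <= (c * mass_arc S x)%:E)%E.
    apply: mass_upper => //; first by rewrite (ltW S0).
    move=> t /andP[St tx]; apply: (dP t _).2.
    by rewrite ltr_norml; apply/andP; split; lra.
  have fx := le_lt_trans up (ltry _).
  have fS : (mass_between x 0%R S < +oo)%E.
    by apply: le_lt_trans (mass_head (m := x) _) _; rewrite ?m0S ?ltry.
  exists (fine (mass_between x S x)).
    rewrite (mass_between_split m0x (S := S)) ?S0// fineD ?ge0_fin_numE//.
  by rewrite fine_ge0//= -lee_fin -fin_between.
have cont1 : {for m, continuous (fun x => fine (mass_between x 0%R S))}.
  by apply: head_continuous; rewrite m0S.
have arcm : c * mass_arc S x @[x --> m] --> c * mass_arc S m.
  apply: cvgM; first exact: cvg_cst.
  apply: (@mass_arc_cvg _ _ _ (fun=> S) (fun x => x)) => //; exact: cvg_cst.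
have md : m < m + d by rewrite ltrDl.
have e3 : 0 < e / 3 by rewrite divr_gt0.
have [j2 -> /andP[j20 j2u]] := split3 m Sm md.
near=> x.
have Sx : S < x by near: x; exact: lt_nbhsr.
have xmd : x < m + d by near: x; exact: lt_nbhsl.
have [i2 -> /andP[i20 i2u]] := split3 x Sx xmd.
have arcx : c * mass_arc S x < e / 3 by near: x; exact: (cvgr_lt _ arcm).
have : `|fine (mass_between m 0%R S) - fine (mass_between x 0%R S)| < e / 3.
  by near: x; move/cvgrPdist_lt : cont1; apply.
by rewrite !ltr_norml => /andP[h1 h2]; apply/andP; split; lra.
Unshelve. all: by end_near. Qed.

(** The mass may grow or shrink with the maximum, so [m1] and [m2] come in either order. *)
Lemma mass_ivt m1 m2 I : m0 < m1 -> m0 < m2 ->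
  (mass_between m1 0%R m1 <= I%:E <= mass_between m2 0%R m2)%E ->
  exists2 m, m0 < m & mass_between m 0%R m = I%:E.
Proof.
move=> m01 m02; pose j x := fine (mass_between x 0%R x).
have jE x : m0 < x -> mass_between x 0%R x = (j x)%:E.
  by move=> x0; rewrite fin_between// mass_finite.
rewrite !jE// !lee_fin => /andP[h1 h2].
have ivt x y : m0 < x -> x <= y -> Num.min (j x) (j y) <= I <= Num.max (j x) (j y) ->
    exists2 m, m0 < m & mass_between m 0%R m = I%:E.
  move=> x0 xy Ixy.
  have cj : {within `[x, y], continuous j}.
    apply: continuous_in_subspaceT => z /set_mem; rewrite /= in_itv/= => /andP[xz _].
    by apply: mass_continuous; exact: lt_le_trans xz.
  have [z] := IVT xy cj Ixy.
  rewrite in_itv/= => /andP[xz _] jz; have z0 := lt_le_trans x0 xz.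
  by exists z => //; rewrite jE// jz.
have [le|/ltW le] := leP m1 m2.
  by apply: (ivt _ _ m01 le); rewrite ge_min le_max h1 h2 orbT.
by apply: (ivt _ _ m02 le); rewrite ge_min le_max h1 h2 orbT.
Qed.

(** * Masses for maxima near infinity, near 0 and near m0 *)

Hypothesis G_oo : G s @[s --> +oo] --> +oo.

Lemma mass_arc0 m : 0 < m -> mass_arc 0 m = pi / (2 * a).
Proof.
move=> m_gt0; rewrite /mass_arc powR0 ?gt_eqF// subr0 addr0 divff ?gt_eqF ?powR_gt0//.
by rewrite sqrtr1 atan1; field; rewrite gt_eqF.
Qed.

(** The cut [S] is fixed where the bound on [G'] starts. As [m] grows, the head vanishes because
    [G m] diverges, and the tail bound tends to the model value; the strict inequality with [J]
    absorbs the error. *)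
Lemma mass_low_oo k J : 0 < k ->
  (\forall t \near +oo, k * t `^ (2 * a - 1) <= G' t) ->
  Num.sqrt (2 * a / k) * (pi / (2 * a)) < J ->
  exists2 m, m0 < m & (mass_between m 0%R m <= J%:E)%E.
Proof.
move=> k0 kG kJ.
have [S [m0S kS]] : exists S, m0 < S /\ forall t, S < t -> k * t `^ (2 * a - 1) <= G' t.
  case: kG => M [_ MP]; exists (Num.max m0 M + 1).
  have [h1 h2] : m0 <= Num.max m0 M /\ M <= Num.max m0 M by rewrite !le_max !lexx orbT.
  by split=> [|t ht]; [lra|apply: MP; lra].
have S0 : 0 < S by exact: le_lt_trans m0S.
pose c := Num.sqrt (2 * a / k).
have lim : (S `^ a / a / Num.sqrt (G m - G S) + c * mass_arc S m) @[m --> +oo] --> c * (pi / (2 * a)).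
  rewrite -[X in _ --> X]add0r; apply: cvgD; last first.
    by apply: cvgM; [exact: cvg_cst|exact: mass_arc_cvgy].
  rewrite -(mulr0 (S `^ a / a)); apply: cvgM; first exact: cvg_cst.
  apply/cvgrPdist_lt => e e0; near=> m.
  have Gm : G S + e ^- 2 < G m by near: m; exact: (cvgry_gt G_oo).
  have GG : 0 < G m - G S by rewrite subr_gt0 (lt_trans _ Gm)// ltrDl invr_gt0 exprn_gt0.
  rewrite sub0r normrN ger0_norm ?invr_ge0 ?sqrtr_ge0// invf_plt ?posrE ?sqrtr_gt0//.
  rewrite -[ltLHS]gtr0_norm ?invr_gt0// -sqrtr_sqr ltr_sqrt// exprVn.
  by rewrite ltrBrDl.
have /filter_ex[m [Sm hm]] : \forall m \near +oo, S < m /\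
    S `^ a / a / Num.sqrt (G m - G S) + c * mass_arc S m < J.
  by near=> m; split; near: m; [apply: nbhs_pinfty_gt; exact: num_real|exact: (cvgr_lt _ lim)].
exists m; first exact: lt_trans Sm.
rewrite (mass_between_split (lt_trans m0S Sm) (S := S)) ?S0//.
apply: (@le_trans _ _ (S `^ a / a / Num.sqrt (G m - G S) + c * mass_arc S m)%:E).
  rewrite EFinD; apply: leeD; first by apply: mass_head; rewrite m0S.
  apply: mass_upper => //; [exact: lt_trans Sm|by rewrite (ltW S0)|].
  by move=> t /andP[St _]; exact: kS.
by rewrite lee_fin ltW.
Unshelve. all: by end_near. Qed.

Lemma mass_high_oo k J : 0 < k ->
  (\forall t \near +oo, G' t <= k * t `^ (2 * a - 1)) ->
  J < Num.sqrt (2 * a / k) * (pi / (2 * a)) ->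
  exists2 m, m0 < m & (J%:E <= mass_between m 0%R m)%E.
Proof.
move=> k0 kG kJ.
have [S [m0S kS]] : exists S, m0 < S /\ forall t, S < t -> G' t <= k * t `^ (2 * a - 1).
  case: kG => M [_ MP]; exists (Num.max m0 M + 1).
  have [h1 h2] : m0 <= Num.max m0 M /\ M <= Num.max m0 M by rewrite !le_max !lexx orbT.
  by split=> [|t ht]; [lra|apply: MP; lra].
have S0 : 0 < S by exact: le_lt_trans m0S.
pose c := Num.sqrt (2 * a / k).
have lim : c * mass_arc S m @[m --> +oo] --> c * (pi / (2 * a)).
  by apply: cvgM; [exact: cvg_cst|exact: mass_arc_cvgy].
have /filter_ex[m [Sm hm]] : \forall m \near +oo, S < m /\ J < c * mass_arc S m.
  by near=> m; split; near: m; [apply: nbhs_pinfty_gt; exact: num_real|exact: (cvgr_gt _ lim)].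
exists m; first exact: lt_trans Sm.
rewrite (mass_between_split (lt_trans m0S Sm) (S := S)) ?S0//.
apply: (@le_trans _ _ (c * mass_arc S m)%:E).
  by rewrite lee_fin ltW.
rewrite -[leLHS]add0e; apply: leeD => //.
apply: mass_lower => //; [exact: lt_trans Sm|by rewrite (ltW S0)|].
by move=> t /andP[St _]; exact: kS.
Unshelve. all: by end_near. Qed.

(** Here the bound on [G'] holds down to 0, so the cut is [S = 0]. The full model arc is pi / (2a)
    for every [m], by scaling, and no limit is taken. *)
Lemma mass_low_0 k : m0 = 0 -> 0 < k ->
  (\forall t \near 0^'+, k * t `^ (2 * a - 1) <= G' t) ->
  exists2 m, m0 < m &
    (mass_between m 0%R m <= (Num.sqrt (2 * a / k) * (pi / (2 * a)))%:E)%E.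
Proof.
move=> m00 k0 [d /= d0 dP]; exists (d / 2); first by rewrite m00 divr_gt0.
rewrite -(@mass_arc0 (d / 2)) ?divr_gt0//; apply: mass_upper => //.
- by rewrite m00 divr_gt0.
- by rewrite lexx divr_gt0.
- move=> t /andP[t0 td]; apply: dP => //.
  by rewrite /= sub0r normrN gtr0_norm//; lra.
Qed.

Lemma mass_high_0 k : m0 = 0 -> 0 < k ->
  (\forall t \near 0^'+, G' t <= k * t `^ (2 * a - 1)) ->
  exists2 m, m0 < m &
    ((Num.sqrt (2 * a / k) * (pi / (2 * a)))%:E <= mass_between m 0%R m)%E.
Proof.
move=> m00 k0 [d /= d0 dP]; exists (d / 2); first by rewrite m00 divr_gt0.
rewrite -(@mass_arc0 (d / 2)) ?divr_gt0//; apply: mass_lower => //.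
- by rewrite m00 divr_gt0.
- by rewrite lexx divr_gt0.
- move=> t /andP[t0 td]; apply: dP => //.
  by rewrite /= sub0r normrN gtr0_norm//; lra.
Qed.

(* The density at [m = m0], where [G m0 = 0]; inversion in [\bar R] makes it
   [+oo] at the zeros of [G]. *)
Definition limit_density s : \bar R :=
  ((s `^ (a - 1))%:E / (Num.sqrt (- G s))%:E)%E.

Hypothesis m0_gt0 : 0 < m0.
Hypothesis G_m0 : G m0 = 0.

Let m_ (n : nat) : R := m0 + n.+1%:R^-1.

Let m_gt n : m0 < m_ n. Proof. by rewrite ltrDl invr_gt0. Qed.

Let G_m_cvg : G (m_ n) @[n --> \oo] --> 0.
Proof.
have m_cvg : m_ n @[n --> \oo] --> m0.
  rewrite -[X in _ --> X]addr0; apply: cvgD; first exact: cvg_cst.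
  exact: cvg_harmonic.
by rewrite -G_m0; exact: (cvg_comp _ _ m_cvg (cG m0_gt0)).
Qed.

(** At a zero of [G] the denominator is the square root of [G (m_ n)], which tends to 0, and the
    density diverges, in agreement with the value +oo. Where [G s < 0] it is plain continuity. *)
Let limit_density_cvg s : 0 < s < m0 ->
  (mass_density (m_ n) s)%:E @[n --> \oo] --> limit_density s.
Proof.
move=> /andP[s0 sm0].
have := G_le0; move=> /(_ s); rewrite s0 (ltW sm0) => /(_ isT).
rewrite le_eqVlt => /predU1P[Gs|Gs].
  rewrite /limit_density Gs oppr0 sqrtr0 inve0 gt0_muley ?lte_fin ?powR_gt0//.
  apply/cvgeryP/cvgryPge => A.
  have P0 : 0 < s `^ (a - 1) by exact: powR_gt0.
  have sq : Num.sqrt (G (m_ n)) @[n --> \oo] --> 0.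
    by rewrite -(@sqrtr0 R); apply: (cvg_comp _ _ G_m_cvg); exact: sqrt_continuous.
  near=> n; rewrite /mass_density Gs subr0.
  rewrite ler_pdivlMr ?sqrtr_gt0 ?G_gt0//.
  have x0 : 0 < Num.sqrt (G (m_ n)) by rewrite sqrtr_gt0 G_gt0.
  have h : Num.sqrt (G (m_ n)) < s `^ (a - 1) / (`|A| + 1).
    by near: n; apply: (cvgr_lt _ sq); rewrite divr_gt0// ltr_wpDl.
  move: h; rewrite ltr_pdivlMr ?ltr_wpDl// mulrC => h; apply: le_trans (ltW h).
  by rewrite ler_wpM2r ?(ltW x0)// (le_trans (ler_norm A))// lerDl.
have sG : Num.sqrt (- G s) != 0 by rewrite gt_eqF// sqrtr_gt0 oppr_gt0.
rewrite /limit_density inver (negbTE sG) -EFinM.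
apply: cvg_EFin; first exact: nearW.
apply: cvgM; first exact: cvg_cst.
apply: cvgV => //; apply: (cvg_comp (fun n => G (m_ n) - G s) Num.sqrt); last exact: sqrt_continuous.
have : G (m_ n) - G s @[n --> \oo] --> 0 - G s.
  by apply: cvgB => //; exact: cvg_cst.
by rewrite sub0r.
Unshelve. all: by end_near. Qed.

Lemma limit_density_meas : measurable_fun `]0, m0[ limit_density.
Proof.
apply: (@emeasurable_fun_cvg _ _ _ _ (fun n s => (mass_density (m_ n) s)%:E)).
  move=> n; apply/measurable_EFinP; apply: dens_meas => //; exact: ltW.
by move=> s /=; rewrite in_itv/= => s0; exact: limit_density_cvg.
Qed.

(** As [m_ n] decreases to [m0], [G (m_ n)] decreases and the densities increase, so monotone
    convergence on []0, m0[] applies even to an infinite limit. The part beyond [m0] is nonnegative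
    and dropped. *)
Lemma mass_high_m0 J :
  (J%:E < \int[lebesgue_measure]_(s in `]0%R, m0[) limit_density s)%E ->
  exists2 m, m0 < m & (J%:E <= mass_between m 0%R m)%E.
Proof.
move=> Jlt.
have H : mass_between (m_ n) 0%R m0 @[n --> \oo] -->
    (\int[lebesgue_measure]_(s in `]0%R, m0[) limit_density s)%E.
  have <- : (\int[lebesgue_measure]_(s in `]0%R, m0[)
      limn (fun n => (mass_density (m_ n) s)%:E) =
      \int[lebesgue_measure]_(s in `]0%R, m0[) limit_density s)%E.
    apply: eq_integral => s /set_mem /=; rewrite in_itv/= => s0.
    exact/cvg_lim/limit_density_cvg.
  apply: cvg_monotone_convergence => //.
  - by move=> n; apply/measurable_EFinP; apply: dens_meas => //; exact: ltW.
  - by move=> n s _; rewrite lee_fin.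
  - move=> s; rewrite /= in_itv/= => /andP[s0 sm0] n k nk.
    rewrite lee_fin ler_wpM2l ?powR_ge0//.
    have kn : m_ k <= m_ n by rewrite lerD2l lef_pV2 ?posrE// ler_nat.
    apply: ler_sqrtV2; first by rewrite subr_gt0 pot_lt// (lt_trans sm0).
    rewrite lerB//; move: kn; rewrite le_eqVlt => /predU1P[->//|kn].
    by apply/ltW/pot_lt => //; exact: lt_trans m0_gt0 (m_gt k).
have : \forall n \near \oo, (J%:E < mass_between (m_ n) 0%R m0)%E.
  exact: (H (fun x => (J%:E < x)%E) (open_ereal_gt' Jlt)).
case=> n _ /(_ n (leqnn n)) /ltW h; exists (m_ n) => //.
rewrite (mass_between_split (m_gt n) (S := m0)) ?m0_gt0 ?m_gt//.
by rewrite -[leLHS]adde0; apply: leeD.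
Qed.

(** On []0, m0[] the density is below its limit because [G m > 0]. The part over []m0, m[] is
    controlled by an arc starting at [m0], which shrinks to 0; the constant for that comparison
    comes from [0 < G' m0]. *)
Lemma mass_low_m0 J : 0 < G' m0 ->
  (\int[lebesgue_measure]_(s in `]0%R, m0[) limit_density s < J%:E)%E ->
  exists2 m, m0 < m & (mass_between m 0%R m <= J%:E)%E.
Proof.
move=> G'm0 Jlt.
have [k [d [k0 d0 dP]]] := near_lower m0_gt0 G'm0.
pose c := Num.sqrt (2 * a / k).
set D := (X in (X < _)%E) in Jlt.
have D0 : (0 <= D)%E.
  by apply: integral_ge0 => s _; rewrite mule_ge0 ?lee_fin ?powR_ge0// inve_ge0 lee_fin sqrtr_ge0.
have DE : D = (fine D)%:E.
  by rewrite fineK// ge0_fin_numE// (lt_trans Jlt) ?ltry.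
have lim : c * mass_arc m0 m @[m --> m0] --> 0.
  rewrite -(mulr0 c) -(mass_arcxx m0); apply: cvgM; first exact: cvg_cst.
  by apply: (@mass_arc_cvg _ _ _ (fun=> m0) (fun x => x)) => //; exact: cvg_cst.
have J0 : 0 < J - fine D by move: Jlt; rewrite DE lte_fin subr_gt0.
near m0^'+ => m.
have m0m : m0 < m by near: m; exact: nbhs_right_gt.
have md : m < m0 + d by near: m; apply: nbhs_right_lt; rewrite ltrDl.
exists m => //; rewrite (mass_between_split m0m (S := m0)) ?m0_gt0//.
apply: (@le_trans _ _ (D + (c * mass_arc m0 m)%:E)%E).
  apply: leeD.
    apply: ge0_le_integral => //.
    - by move=> s _; rewrite lee_fin.
    - by apply/measurable_EFinP; apply: dens_meas => //; exact: ltW.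
    - exact: limit_density_meas.
    - move=> s; rewrite /= in_itv/= => /andP[s0 sm0].
      rewrite /mass_density /limit_density EFinM.
      rewrite lee_wpmul2l ?lee_fin ?powR_ge0//.
      have Gs : G s <= 0 by apply: G_le0; rewrite s0 ltW.
      move: Gs; rewrite le_eqVlt => /predU1P[->|Gs].
        by rewrite oppr0 sqrtr0 inve0 leey.
      rewrite inver gt_eqF ?sqrtr_gt0 ?oppr_gt0// lee_fin.
      by apply: ler_sqrtV2; rewrite ?oppr_gt0// lerDr ltW// G_gt0.
  apply: mass_upper => //; first by rewrite (ltW m0_gt0).
  move=> t /andP[m0t tm]; apply: (dP t _).2.
  by rewrite distrC gtr0_norm ?subr_gt0//; lra.
rewrite DE -EFinD lee_fin -lerBrDl.
by apply: ltW; near: m; apply: (cvgr_lt _ (cvg_at_right_filter lim)).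
Unshelve. all: by end_near. Qed.

End mass.

(** * The four cases *)

Section ray.
Variables (R : realType) (F : R -> R).
Hypothesis C1F : C1_ray F.

Lemma ray_derive_cvg (s : R) : 0 <= s ->
  (F t - F s) / (t - s) @[t --> within `[0, +oo[ s^'] --> ray_derive F s.
Proof. by case: C1F => dF _ /dF; exact: cvgP. Qed.

Lemma is_derive_ray (s : R) : 0 < s -> is_derive s 1 F (ray_derive F s).
Proof.
move=> s0; have cF := ray_derive_cvg (ltW s0).
suff H : (fun h : R => h^-1 *: ((F \o shift s) (h *: (1 : R)) - F s)) @ 0^' --> ray_derive F s.
  by split; [apply/cvg_ex; exists (ray_derive F s)|apply/cvg_lim].
apply/cvgrPdist_lt => e e0.
have /cvgrPdist_lt/(_ e e0) [d /= d0 dP] := cF.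
near=> h => /=.
have h0 : h != 0 by near: h; exact: nbhs_dnbhs_neq.
have : `|h| < Num.min d s by near: h; apply: dnbhs0_lt; rewrite lt_min d0.
rewrite lt_min => /andP[hd hs].
rewrite /GRing.scale/= mulr1 mulrC.
have := dP (h + s); rewrite addrK; apply.
- by rewrite /ball_/= opprD addrCA subrr addr0 normrN.
- by rewrite -subr_eq0 addrK.
- by rewrite /= in_itv/= andbT; move: hs; rewrite ltr_norml => /andP[]; lra.
Unshelve. all: by end_near. Qed.

Lemma continuous_ray_derive (s : R) : 0 < s -> {for s, continuous (ray_derive F)}.
Proof.
by case: C1F => _ /continuous_within_itvcyP[cF _] s0; apply: cF; rewrite in_itv/= s0.
Qed.

Lemma ray_derive_right0 : (F t - F 0) / t @[t --> 0^'+] --> ray_derive F 0.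
Proof.
have /cvgrPdist_lt cF := ray_derive_cvg (lexx 0).
apply/cvgrPdist_lt => e /cF [d /= d0 dP]; exists d => //= t td t0.
have := dP t td; rewrite subr0; apply; first by rewrite gt_eqF.
by rewrite /= in_itv/= andbT ltW.
Qed.

Lemma ray_right0 : F t @[t --> 0^'+] --> F 0.
Proof.
have H : (F t - F 0) / t * t + F 0 @[t --> 0^'+] --> ray_derive F 0 * 0 + F 0.
  apply: cvgD; last exact: cvg_cst.
  apply: cvgM; first exact: ray_derive_right0.
  by apply: cvg_at_right_filter; exact: cvg_id.
move: H; rewrite mulr0 add0r; apply: cvg_trans; apply: near_eq_cvg; near=> t.
by rewrite divfK ?subrK// gt_eqF.
Unshelve. all: by end_near. Qed.

Lemma continuous_ray : {within `[0, +oo[, continuous F}.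
Proof.
apply/continuous_within_itvcyP; split; last exact: ray_right0.
move=> s; rewrite in_itv/= andbT => s0.
have [d _] := is_derive_ray s0.
exact/differentiable_continuous/derivable1_diffP.
Qed.

Variable p : R.
Hypothesis p_gt1 : 1 < p.
Hypothesis F0 : F s / s `^ p @[s --> 0^'+] --> 0.

Let p_gt0 : 0 < p. Proof. exact: lt_trans p_gt1. Qed.

Lemma ray_at0 : F 0 = 0.
Proof.
have H : F t / t `^ p * t `^ p @[t --> 0^'+] --> (0 * 0 : R).
  by apply: cvgM F0 _; exact: powR_cvg0.
have {}H : F t @[t --> 0^'+] --> 0.
  rewrite mul0r in H; apply: cvg_trans H; apply: near_eq_cvg; near=> t.
  by rewrite divfK// gt_eqF// powR_gt0.
exact: (cvg_unique _ ray_right0 H).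
Unshelve. all: by end_near. Qed.

(** The difference quotient is (F(t) / t^p) t^(p-1) and [p > 1]. This gives [h 0 = 0], so that 0 is
    a rest point and the profile can be extended by 0. *)
Lemma ray_derive_at0 : ray_derive F 0 = 0.
Proof.
have H : F t / t `^ p * t `^ (p - 1) @[t --> 0^'+] --> (0 * 0 : R).
  by apply: cvgM F0 _; apply: powR_cvg0; rewrite subr_gt0.
have {}H : (F t - F 0) / t @[t --> 0^'+] --> 0.
  rewrite mul0r in H; apply: cvg_trans H; apply: near_eq_cvg; near=> t.
  have t0 : 0 < t by [].
  rewrite ray_at0 subr0 powRB; last by rewrite gt_eqF// implybT.
  rewrite powRr1 ?ltW//; field.
  by rewrite !gt_eqF// powR_gt0.
exact: (cvg_unique _ ray_derive_right0 H).
Unshelve. all: by end_near. Qed.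

Let G s := F s / s `^ p.
Let G' s := (ray_derive F s * s - p * F s) / s `^ (p + 1).

Lemma is_derive_ray_ratio (s : R) : 0 < s -> is_derive s 1 G (G' s).
Proof.
move=> s0.
have dp := is_deriveM (is_derive_ray s0) (is_derive1_powR (- p) s0).
have E : \forall t \near s, (F * (@powR R ^~ (- p))) t = G t.
  by near=> t; rewrite /G -powRN.
apply: (is_derive_eq (near_eq_is_derive E dp)).
rewrite /G' /GRing.scale/= -opprD !powRN.
have -> : s `^ (p + 1) = s `^ p * s.
  by rewrite powRD ?powRr1 ?(ltW s0)// (gt_eqF s0) implybT.
field.
by rewrite !gt_eqF// powR_gt0.
Unshelve. all: by end_near. Qed.

Lemma continuous_ray_ratio' (s : R) : 0 < s -> {for s, continuous G'}.
Proof.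
move=> s0; apply: cvgM; last first.
  by apply: cvgV; [rewrite gt_eqF// powR_gt0|exact: continuous_powR_gt0].
apply: cvgB.
  by apply: cvgM; [exact: continuous_ray_derive|exact: cvg_id].
apply: cvgM; first exact: cvg_cst.
have [d _] := is_derive_ray s0.
exact/differentiable_continuous/derivable1_diffP.
Qed.

Hypothesis Foo : F s / s `^ p @[s --> +oo] --> +oo.
Hypothesis a1 : forall s : R, 0 < s -> 0 < F s -> 0 < ray_derive F s * s - p * F s.

Lemma ray_ratio'_gt0 (s : R) : 0 < s -> 0 < F s -> 0 < G' s.
Proof. by move=> s0 Fs; rewrite divr_gt0 ?powR_gt0 ?a1. Qed.

Let G_gt0 (s : R) : 0 < s -> (0 < G s) = (0 < F s).
Proof. by move=> s0; rewrite pmulr_lgt0// invr_gt0 powR_gt0. Qed.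

(** At a maximum point [c] of [G] on [[t, r]] one has [G c > 0], hence [G' c > 0] by (a1). If
    [c < r], [G] would increase just after [c]; so the maximum is at [r]. *)
Lemma ray_pos_up (t r : R) : 0 < t -> t <= r -> 0 < F t -> 0 < F r.
Proof.
move=> t0 tr Ft.
have dG s : 0 < s -> {for s, continuous G}.
  by move=> /is_derive_ray_ratio[d _]; exact/differentiable_continuous/derivable1_diffP.
have cG : {within `[t, r], continuous G}.
  apply: continuous_in_subspaceT => s /set_mem; rewrite /= in_itv/= => /andP[ts _].
  by apply: dG; exact: lt_le_trans ts.
have [c] := EVT_max tr cG; rewrite in_itv/= => /andP[tc cr] cmax.
have c0 := lt_le_trans t0 tc.
have Gc : 0 < G c.
  by apply: (@lt_le_trans _ _ (G t)); [rewrite G_gt0|apply: cmax; rewrite in_itv/= lexx].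
move: cr; rewrite le_eqVlt => /predU1P[<-|cr]; first by rewrite -G_gt0.
exfalso.
have Fc : 0 < F c by rewrite -G_gt0.
have := cvgr_gt _ (continuous_ray_ratio' c0) _ (ray_ratio'_gt0 c0 Fc).
case=> d /= d0 dP.
pose x := Num.min r (c + d / 2).
have cx : c < x by rewrite lt_min cr/=; lra.
have xr : x <= r by rewrite ge_min lexx.
have xd : x <= c + d / 2 by rewrite ge_min lexx orbT.
have [||z /[!in_itv]/= /andP[cz zx] E] := @MVT R G G' c x cx.
- by move=> z; rewrite in_itv/= => /andP[cz _]; apply: is_derive_ray_ratio; exact: lt_trans cz.
- apply: continuous_subspaceW cG; apply: subset_itv; rewrite bnd_simp//.
have : G x <= G c by apply: cmax; rewrite in_itv/= xr (le_trans tc) ?ltW.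
rewrite leNgt -subr_gt0 E mulr_gt0 ?subr_gt0//.
by apply: dP; rewrite /ball_/= distrC gtr0_norm ?subr_gt0//; lra.
Qed.

Let m0 := m_0 F.

(** If [F s <= 0] for some [s > m0], then [ray_pos_up] would force [F <= 0] on all of [[0, s]],
    against the maximality of [m0]. The zero at [m0 > 0] is the meeting of both signs. *)
Lemma m_0_ray : [/\ 0 <= m0, forall s, 0 < s <= m0 -> G s <= 0,
  forall s, m0 < s -> 0 < F s & 0 < m0 -> F m0 = 0].
Proof.
have [T T0 FT] : exists2 T, 0 <= T & 0 < F T.
  have /filter_ex[T [T0 FT]] : \forall T \near +oo, 0 < T /\ 0 < G T.
    near=> T; split; near: T; first by apply: nbhs_pinfty_gt; exact: num_real.
    exact: (cvgry_gt Foo).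
  by exists T; [exact: ltW|rewrite -G_gt0].
have [m00 mle mmax] : [/\ 0 <= m_0 F,
      forall s : R, 0 <= s <= m_0 F -> F s <= 0
    & forall t : R, 0 <= t -> (forall s : R, 0 <= s <= t -> F s <= 0) ->
        t <= m_0 F].
  by apply: m_0P; [exact: continuous_ray|rewrite ray_at0|exists T].
have pos s : m0 < s -> 0 < F s.
  move=> ms; have s0 : 0 < s by exact: le_lt_trans ms.
  have [//|Fs] := ltP 0 (F s); exfalso.
  move: ms; rewrite ltNge => /negP; apply; apply: mmax; first exact: ltW.
  move=> r /andP[r0 rs]; rewrite leNgt; apply/negP => Fr.
  have r1 : 0 < r.
    by rewrite lt_neqAle r0 andbT; apply: contraTneq Fr => <-; rewrite ray_at0 ltxx.
  by have := ray_pos_up r1 rs Fr; rewrite ltNge Fs.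
split=> //.
- move=> s /andP[s0 sm]; rewrite pmulr_lle0 ?invr_gt0 ?powR_gt0// mle// (ltW s0)//.
- move=> m0_gt0; apply/eqP; rewrite eq_le mle ?lexx ?(ltW m0_gt0)//=.
  have [d _] := is_derive_ray m0_gt0.
  have cF : F t @[t --> m0^'+] --> F m0.
    by apply: cvg_at_right_filter; apply/differentiable_continuous/derivable1_diffP.
  rewrite leNgt; apply/negP => Fm.
  have h : \forall t \near m0^'+, F t < 0 by exact: (cvgr_lt _ cF).
  near m0^'+ => t; have : F t < 0 by near: t; exact: h.
  by rewrite ltNge ltW// pos.
Unshelve. all: by end_near. Qed.

Lemma ray_soliton (q rho m : R) : 0 < q -> 0 < m -> 0 < F m ->
  (forall s, 0 < s < m -> G s < G m) ->
  mass_between G (q - p / 2 + 1) m 0%R m = (rho / Num.sqrt 2)%:E ->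
  exists (lambda : R) (u : R -> R),
    [/\ 0 < lambda,
        C2 u,
        forall x : R,
          - (u^`(2))%classic x + lambda * u x `^ (p - 1) = ray_derive F (u x)
      & (\int[lebesgue_measure]_x (u x `^ q)%:E = rho%:E)%E] /\
    [/\ (u^`())%classic \in Lfun lebesgue_measure 2%:E,
        forall x : R, 0 <= u x,
        forall x : R, u (- x) = u x,
        u x @[x --> +oo] --> 0
      & u x @[x --> -oo] --> 0].
Proof.
move=> q_gt0 m_gt0 Fm Gm massJ.
have Gm0 : 0 < G m by rewrite G_gt0.
(* The multiplier is [p * G m]: it makes [h] the derivative of [H], and [H] vanish at [m]. *)
pose H s := G m * `|s| `^ p - F s.
pose h s := p * G m * `|s| `^ (p - 1) - ray_derive F s.
have sub : `[0, m] `<=` `[0, +oo[ by apply: subset_itv; rewrite bnd_simp.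
have cH : {within `[0, m], continuous H}.
  move=> x; apply: cvgB; last exact: (continuous_subspaceW sub continuous_ray).
  apply: cvgM; first exact: cvg_cst.
  by apply: continuous_subspaceT x => x; exact: continuous_powR_norm.
have ch : {within `[0, m], continuous h}.
  case: C1F => _ cdF.
  move=> x; apply: cvgB; last exact: (continuous_subspaceW sub cdF).
  apply: cvgM; first exact: cvg_cst.
  by apply: continuous_subspaceT x => x; apply: continuous_powR_norm; rewrite subr_gt0.
have HE s : 0 < s -> H s = s `^ p * (G m - G s).
  move=> s0; rewrite /H gtr0_norm// /G; field.
  by rewrite !gt_eqF// powR_gt0.
have H_gt0 s : 0 < s < m -> 0 < H s.
  by move=> sm; have /andP[s0 _] := sm; rewrite HE// mulr_gt0 ?powR_gt0// subr_gt0 Gm.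
have dH s : 0 < s < m -> is_derive s 1 H (h s).
  move=> /andP[s0 _].
  have d := is_deriveB (is_deriveZ (G m) (is_derive1_powR p s0)) (is_derive_ray s0).
  have E : \forall t \near s, (G m \*: (@powR R ^~ p) - F) t = H t.
    near=> t; rewrite /H ger0_norm//.
    by apply: ltW; near: t; exact: lt_nbhsr.
  apply: (is_derive_eq (near_eq_is_derive E d)).
  by rewrite /h gtr0_norm// /GRing.scale/= mulrA (mulrC p).
have H0 : H 0 = 0 by rewrite /H normr0 powR0 ?gt_eqF// mulr0 ray_at0 subr0.
have Hm : H m = 0 by rewrite HE// subrr mulr0.
have h0 : h 0 = 0.
  by rewrite /h normr0 powR0 ?gt_eqF ?subr_gt0// mulr0 ray_derive_at0 subr0.
have s2 : 0 < Num.sqrt (2 : R) by rewrite sqrtr_gt0.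
have massI : (\int[lebesgue_measure]_(s in `]0%R, m[)
    (s `^ q / Num.sqrt (2 * H s))%:E = (rho / 2)%:E)%E.
  (* Here sqrt (2 H(s)) = sqrt 2 s^(p/2) sqrt (G(m) - G(s)); the half mass rho / 2 is then (rho /
     sqrt 2) / sqrt 2. *)
  have densE s : s \in (`]0%R, m[%classic : set R) -> (s `^ q / Num.sqrt (2 * H s))%:E =
      ((Num.sqrt 2)^-1%:E * (mass_density G (q - p / 2 + 1) m s)%:E)%E.
    move=> /set_mem /=; rewrite in_itv/= => sm; have /andP[s0 _] := sm.
    rewrite -EFinM; congr EFin; rewrite HE// sqrtrM// sqrtrM ?powR_ge0//.
    rewrite -(powR12_sqrt (powR_ge0 _ _)) -powRrM /mass_density addrK.
    rewrite powRB; last by rewrite (gt_eqF s0) implybT.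
    have GG : Num.sqrt (G m - G s) != 0 by rewrite gt_eqF// sqrtr_gt0 subr_gt0 Gm.
    field.
    by rewrite GG !gt_eqF// powR_gt0.
  transitivity (\int[lebesgue_measure]_(s in `]0%R, m[)
      ((Num.sqrt 2)^-1%:E * (mass_density G (q - p / 2 + 1) m s)%:E))%E.
    exact: eq_integral.
  rewrite ge0_integralZl_EFin//; last 2 first.
  - by move=> s _; rewrite lee_fin divr_ge0 ?powR_ge0 ?sqrtr_ge0.
  - apply/measurable_EFinP; apply: open_continuous_measurable_fun => // s /set_mem.
    rewrite /= in_itv/= => sm; have /andP[s0 _] := sm.
    apply: cvgM; first exact: continuous_powR_gt0.
    apply: cvgV; first by rewrite gt_eqF// sqrtr_gt0 subr_gt0 Gm.
    apply: (@continuous_comp _ _ _ (fun s => G m - G s) Num.sqrt); last exact: sqrt_continuous.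
    apply: cvgB; first exact: cvg_cst.
    by have [d _] := is_derive_ray_ratio s0; exact/differentiable_continuous/derivable1_diffP.
  rewrite -/(mass_between _ _ _ _ _) massJ -EFinM; congr EFin.
  rewrite mulrC -mulrA -invfM -expr2 sqr_sqrtr//.
have [u [[uC2 uE mu] [uL2 um uN u1 u2]]] := homoclinic_profile q_gt0 m_gt0 cH ch H0 Hm h0 H_gt0 dH massI.
have u0 x : 0 <= u x by case/andP: (um x).
exists (p * G m), u; split; split=> //.
- by rewrite mulr_gt0.
- move=> x; rewrite uE /h ger0_norm// opprB addrC addrCA subrr addr0//.
- by rewrite mu mulrC divfK.
Unshelve. all: by end_near. Qed.

End ray.

(** * From limits and thresholds to real bounds *)

Lemma limf_einf_gt (R : realType) (f : R -> R) (Fl : set_system R) (K : R) :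
  Filter Fl -> (K%:E < limf_einf (EFin \o f) Fl)%E ->
  exists2 k, K < k & Fl [set t | k <= f t].
Proof.
move=> FF; rewrite limf_einfE => /ereal_sup_gt[_ [V FV <-]] KV.
have [k Kk kV] : exists2 k, K < k & (k%:E <= ereal_inf [set (EFin \o f) x | x in V])%E.
  case: ereal_inf KV => [r||//]; rewrite ?lte_fin => Kr; first by exists r.
  by exists (K + 1); rewrite ?ltrDl ?leey.
exists k => //; apply: filterS FV => t Vt.
rewrite /= -lee_fin; apply: (le_trans kV); apply: ereal_inf_lbound; by exists t.
Qed.

(** The limit may be nonpositive or -oo, but the comparisons need a positive rate: since [K > 0],
    the bound can be raised to at least [K / 2]. *)
Lemma limf_esup_lt (R : realType) (f : R -> R) (Fl : set_system R) (K : R) :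
  Filter Fl -> 0 < K -> (limf_esup (EFin \o f) Fl < K%:E)%E ->
  exists k, [/\ 0 < k, k < K & Fl [set t | f t <= k]].
Proof.
move=> FF K0; rewrite limf_esupE => /ereal_inf_lt[_ [V FV <-]] VK.
have [k [k0 kK Vk]] : exists k, [/\ 0 < k, k < K & (ereal_sup [set (EFin \o f) x | x in V] <= k%:E)%E].
  case: ereal_sup VK => [r|//|_].
    rewrite lte_fin => Kr; exists (Num.max r (K / 2)); rewrite lt_max gt_max Kr lee_fin le_max lexx.
    by split=> //; [rewrite divr_gt0 ?orbT|rewrite /=; lra].
  by exists (K / 2); rewrite leNye; split=> //; lra.
exists k; split=> //; apply: filterS FV => t Vt.
rewrite /= -lee_fin; apply: le_trans Vk; apply: ereal_sup_ubound; by exists t.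
Qed.

Section threshold.
Variables (R : realType) (p q rho : R).
Hypothesis a_gt0 : 0 < q - p / 2 + 1.
Hypothesis rho_gt0 : 0 < rho.
Let a := q - p / 2 + 1.
Let pi0 : 0 < pi :> R := pi_gt0 R.

(* The value of [k] at which the threshold equals [rho]. *)
Definition critical_rate : R := pi ^+ 2 / (a * rho ^+ 2).

Lemma critical_rate_gt0 : 0 < critical_rate.
Proof. by rewrite divr_gt0 ?exprn_gt0 ?pi0// mulr_gt0 ?exprn_gt0. Qed.

Let thresholdE (r : R) : 0 < r ->
  threshold p q r%:E = (pi / Num.sqrt (a * r))%:E.
Proof.
move=> r0; rewrite /threshold -EFinM /= inver gt_eqF// sqrtr_gt0 mulr_gt0//.
Qed.

Let threshold_le0 (r : R) : r <= 0 -> threshold p q r%:E = +oo%E.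
Proof.
move=> r0; rewrite /threshold -EFinM /= ler0_sqrtr; last by rewrite mulr_ge0_le0// ltW.
by rewrite inve0 gt0_muley// lte_fin pi0.
Qed.

Let sq_lt (r : R) : 0 < r -> (pi / Num.sqrt (a * r) < rho) = (critical_rate < r).
Proof.
move=> r0; rewrite ltr_pdivrMr ?sqrtr_gt0 ?mulr_gt0//.
rewrite -(ltr_pXn2r (n := 2)) ?nnegrE ?pi_ge0 ?mulr_ge0 ?sqrtr_ge0 ?ltW//.
rewrite exprMn sqr_sqrtr ?mulr_ge0 ?ltW// /critical_rate ltr_pdivrMr ?mulr_gt0 ?exprn_gt0//.
by congr (_ < _); ring.
Qed.

Let sq_gt (r : R) : 0 < r -> (rho < pi / Num.sqrt (a * r)) = (r < critical_rate).
Proof.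
move=> r0; rewrite ltr_pdivlMr ?sqrtr_gt0 ?mulr_gt0//.
rewrite -(ltr_pXn2r (n := 2)) ?nnegrE ?pi_ge0 ?mulr_ge0 ?sqrtr_ge0 ?ltW//.
rewrite exprMn sqr_sqrtr ?mulr_ge0 ?ltW// /critical_rate ltr_pdivlMr ?mulr_gt0 ?exprn_gt0//.
by congr (_ < _); ring.
Qed.

(** For [k <= 0], including -oo, the square root is 0 and the threshold +oo, which is never below
    [rho]; for positive [k] the threshold decreases. *)
Lemma threshold_lt (k : \bar R) : (threshold p q k < rho%:E)%E ->
  (critical_rate%:E < k)%E.
Proof.
case: k => [r||]; last 2 first.
- by rewrite ltry.
- by rewrite /threshold gt0_muleNy ?lte_fin//= inve0 gt0_muley ?lte_fin ?pi0// ltNge leey.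
have [r0|r0] := leP r 0; first by rewrite threshold_le0// ltNge leey.
by rewrite thresholdE// !lte_fin sq_lt.
Qed.

Lemma threshold_gt (k : \bar R) : (rho%:E < threshold p q k)%E ->
  (k < critical_rate%:E)%E.
Proof.
case: k => [r||]; last 2 first.
- have -> : threshold p q +oo = 0%E :> \bar R.
    by rewrite /threshold gt0_muley ?lte_fin// [sqrte _]/= invey mule0.
  by rewrite lte_fin ltNge ltW.
- by rewrite ltNyr.
have [r0|r0] := leP r 0; first by rewrite lte_fin (le_lt_trans r0)// critical_rate_gt0.
by rewrite thresholdE// !lte_fin sq_gt.
Qed.

(** At the critical rate the model integral pi / sqrt (2ak) is exactly the target rho / sqrt 2. *)
Let rate_value : Num.sqrt (2 * a / critical_rate) * (pi / (2 * a)) = rho / Num.sqrt 2.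
Proof.
rewrite /critical_rate; move: (pi) pi0 => c c0.
have cN : c != 0 by rewrite gt_eqF.
have aN : a != 0 by rewrite gt_eqF.
have rN : rho != 0 by rewrite gt_eqF.
have -> : 2 * a / (c ^+ 2 / (a * rho ^+ 2)) = 2 * (a * rho / c) ^+ 2.
  by field; rewrite cN rN.
rewrite sqrtrM// sqrtr_sqr gtr0_norm ?divr_gt0 ?mulr_gt0//.
have s2 : Num.sqrt (2 : R) != 0 by rewrite gt_eqF// sqrtr_gt0.
apply: (mulIf s2); rewrite divfK//.
have -> : Num.sqrt 2 * (a * rho / c) * (c / (2 * a)) * Num.sqrt 2 =
  rho / 2 * (Num.sqrt 2) ^+ 2 :> R by field; rewrite cN aN.
by rewrite sqr_sqrtr// divfK.
Qed.

Lemma rate_lt k : critical_rate < k ->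
  Num.sqrt (2 * a / k) * (pi / (2 * a)) < rho / Num.sqrt 2.
Proof.
move=> kk; have k0 := lt_trans critical_rate_gt0 kk.
rewrite -rate_value ltr_pM2r ?divr_gt0 ?pi0 ?mulr_gt0//.
rewrite ltr_sqrt ?divr_gt0 ?mulr_gt0 ?critical_rate_gt0//.
by rewrite ltr_pM2l ?mulr_gt0// ltf_pV2 ?posrE// critical_rate_gt0.
Qed.

Lemma rate_gt k : 0 < k -> k < critical_rate ->
  rho / Num.sqrt 2 < Num.sqrt (2 * a / k) * (pi / (2 * a)).
Proof.
move=> k0 kk.
rewrite -rate_value ltr_pM2r ?divr_gt0 ?pi0 ?mulr_gt0//.
rewrite ltr_sqrt ?divr_gt0 ?mulr_gt0//.
by rewrite ltr_pM2l ?mulr_gt0// ltf_pV2 ?posrE// critical_rate_gt0.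
Qed.

End threshold.

(** * Masses below and above the target *)

Section cases.
Variables (R : realType) (p q rho : R) (F : R -> R).
Hypothesis p_gt1 : 1 < p.
Hypothesis q_gt0 : 0 < q.
Hypothesis a_gt0 : 0 < q - p / 2 + 1.
Hypothesis rho_gt0 : 0 < rho.
Hypothesis C1F : C1_ray F.
Hypothesis F0 : F s / s `^ p @[s --> 0^'+] --> 0.
Hypothesis Foo : F s / s `^ p @[s --> +oo] --> +oo.
Hypothesis a1 : forall s : R, 0 < s -> 0 < F s -> 0 < ray_derive F s * s - p * F s.

Let a := q - p / 2 + 1.
(** The target for [mass_between], since the mass of the profile is sqrt 2 times that integral. *)
Let J := rho / Num.sqrt 2.
Let m0 := m_0 F.
Let G s := F s / s `^ p.
Let G' s := (ray_derive F s * s - p * F s) / s `^ (p + 1).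
Let kappa := critical_rate p q rho.

Let m0P := m_0_ray C1F p_gt1 F0 Foo a1.
Let m0_ge0 : 0 <= m0. Proof. by case: m0P. Qed.
Let G_le0 s : 0 < s <= m0 -> G s <= 0. Proof. by case: m0P => _ h _ _; exact: h. Qed.
Let F_gt0 s : m0 < s -> 0 < F s. Proof. by case: m0P => _ _ h _; exact: h. Qed.
Let G_gt0 s : m0 < s -> 0 < G s.
Proof. by move=> ms; rewrite divr_gt0 ?F_gt0// powR_gt0// (le_lt_trans _ ms). Qed.
Let dG (s : R) : 0 < s -> is_derive s 1 G (G' s).
Proof. exact: is_derive_ray_ratio. Qed.
Let cG' (s : R) : 0 < s -> {for s, continuous G'}.
Proof. exact: continuous_ray_ratio'. Qed.
Let G'_gt0 s : m0 < s -> 0 < G' s.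
Proof.
by move=> ms; apply: ray_ratio'_gt0 => //; [exact: le_lt_trans ms|exact: F_gt0].
Qed.

(** This identifies [quot] with the rate of the power comparison; the exponents agree because 2q + 2
    = (2a - 1) + (p + 1). *)
Let quotE s : 0 < s -> G' s = quot p q F s * s `^ (2 * a - 1).
Proof.
move=> s0; rewrite /G' /quot.
have -> : s `^ (2 * q + 2) = s `^ (2 * a - 1) * s `^ (p + 1).
  rewrite -powRD; last by rewrite (gt_eqF s0) implybT.
  by congr (_ `^ _); rewrite /a; field.
field.
by rewrite !gt_eqF// powR_gt0.
Qed.

Definition mass_low := exists2 m, m0 < m & (mass_between G a m 0%R m <= J%:E)%E.
Definition mass_high := exists2 m, m0 < m & (J%:E <= mass_between G a m 0%R m)%E.

Lemma low_k_oo : (kappa%:E < k_oo p q F)%E -> mass_low.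
Proof.
move=> /limf_einf_gt[k kk kP]; have k0 := lt_trans (critical_rate_gt0 a_gt0 rho_gt0) kk.
apply: (mass_low_oo a_gt0 m0_ge0 dG G'_gt0 G_le0 G_gt0 Foo k0); last exact: rate_lt.
near=> t; have t0 : 0 < t by [].
rewrite quotE// ler_wpM2r ?powR_ge0//; near: t; exact: kP.
Unshelve. all: by end_near. Qed.

Lemma high_K_oo : (K_oo p q F < kappa%:E)%E -> mass_high.
Proof.
move=> /limf_esup_lt[|k [k0 kk kP]]; first exact: critical_rate_gt0.
apply: (mass_high_oo a_gt0 m0_ge0 dG G'_gt0 G_le0 G_gt0 k0); last exact: rate_gt.
near=> t; have t0 : 0 < t by [].
rewrite quotE// ler_wpM2r ?powR_ge0//; near: t; exact: kP.
Unshelve. all: by end_near. Qed.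

Lemma low_k_0 : m0 = 0 -> (kappa%:E < k_0 p q F)%E -> mass_low.
Proof.
move=> m00 /limf_einf_gt[k kk kP]; have k0 := lt_trans (critical_rate_gt0 a_gt0 rho_gt0) kk.
have [|m m0m mk] := mass_low_0 a_gt0 dG G'_gt0 G_le0 G_gt0 m00 k0; last first.
- by exists m => //; apply: (le_trans mk); rewrite lee_fin ltW// rate_lt.
near=> t; have t0 : 0 < t by [].
rewrite quotE// ler_wpM2r ?powR_ge0//; near: t; exact: kP.
Unshelve. all: by end_near. Qed.

Lemma high_K_0 : m0 = 0 -> (K_0 p q F < kappa%:E)%E -> mass_high.
Proof.
move=> m00 /limf_esup_lt[|k [k0 kk kP]]; first exact: critical_rate_gt0.
have [|m m0m mk] := mass_high_0 a_gt0 dG G'_gt0 G_le0 G_gt0 m00 k0; last first.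
- by exists m => //; apply: le_trans mk; rewrite lee_fin ltW// rate_gt.
near=> t; have t0 : 0 < t by [].
rewrite quotE// ler_wpM2r ?powR_ge0//; near: t; exact: kP.
Unshelve. all: by end_near. Qed.

Let G_m0 : 0 < m0 -> G m0 = 0.
Proof. by case: m0P => _ _ _ h /h; rewrite /G => ->; rewrite mul0r. Qed.

(** Inside []0, m0[], sqrt |F(s)| = s^(p/2) sqrt (-G(s)) and s^(q - p/2) = s^(a-1). At zeros of [F]
    both integrands are +oo, and the endpoints are negligible. *)
Lemma I_F_limit_density : 0 < m0 -> I_F q F =
  ((Num.sqrt 2)%:E * \int[lebesgue_measure]_(s in `]0%R, m0[) limit_density G a s)%E.
Proof.
move=> m0_gt0; rewrite /I_F -/m0.
apply: (congr1 (fun x => (Num.sqrt 2)%:E * x)%E).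
have E s : s \in (`]0%R, m0[%classic : set R) ->
    ((s `^ q)%:E / (Num.sqrt `|F s|)%:E = limit_density G a s)%E.
  move=> /set_mem /=; rewrite in_itv/= => /andP[s0 sm0].
  have Gs : G s <= 0 by apply: G_le0; rewrite s0 ltW.
  have FE : F s = G s * s `^ p by rewrite /G divfK// gt_eqF// powR_gt0.
  have NF : Num.sqrt `|F s| = s `^ (p / 2) * Num.sqrt (- G s).
    rewrite FE normrM (ler0_norm Gs) (ger0_norm (powR_ge0 _ _)) mulrC sqrtrM ?powR_ge0//.
    by rewrite -(powR12_sqrt (powR_ge0 _ _)) -powRrM.
  rewrite /limit_density NF; have [G0|G0] := eqVneq (Num.sqrt (- G s)) 0.
    by rewrite G0 mulr0 inve0 !gt0_muley// lte_fin powR_gt0.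
  rewrite !inver mulf_eq0 (negbTE G0) orbF gt_eqF ?powR_gt0//.
  rewrite -!EFinM; congr EFin; rewrite /a addrK powRB; last by rewrite (gt_eqF s0) implybT.
  by field; rewrite G0 gt_eqF// powR_gt0.
have mD := limit_density_meas a_gt0 dG G'_gt0 G_le0 G_gt0 m0_gt0 (G_m0 m0_gt0).
rewrite integral_itv_bndoo; first exact: eq_integral.
by apply: eq_measurable_fun mD => s sI; rewrite E.
Qed.

Lemma high_I_F : 0 < m0 -> (rho%:E < I_F q F)%E -> mass_high.
Proof.
move=> m0_gt0; rewrite I_F_limit_density// => h.
apply: (mass_high_m0 a_gt0 dG G'_gt0 G_le0 G_gt0 m0_gt0 (G_m0 m0_gt0)).
by rewrite /J [rho / _]mulrC EFinM lte_pdivrMl// sqrtr_gt0.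
Qed.

(** As [F m0 = 0], [G' m0] is a positive multiple of the derivative of [F] at [m0], hence nonzero;
    it is positive as a limit of the positive values of [G'] to the right of [m0]. *)
Lemma low_I_F : 0 < m0 -> ray_derive F m0 != 0 -> (I_F q F < rho%:E)%E -> mass_low.
Proof.
move=> m0_gt0 dF0; rewrite I_F_limit_density// => h.
apply: (mass_low_m0 a_gt0 dG cG' G'_gt0 G_le0 G_gt0 m0_gt0 (G_m0 m0_gt0)); last first.
  by rewrite /J [rho / _]mulrC EFinM lte_pdivlMl// sqrtr_gt0.
have Fm0 : F m0 = 0 by case: m0P => _ _ _; apply.
have G'm0 : G' m0 != 0.
  by rewrite /G' Fm0 mulr0 subr0 !mulf_neq0 ?invr_eq0// gt_eqF// powR_gt0.
rewrite lt_neqAle eq_sym G'm0 leNgt/=; apply/negP => lt0.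
have h1 : \forall t \near m0^'+, G' t < 0.
  by apply: (cvgr_lt _ (cvg_at_right_filter (cG' m0_gt0))).
near m0^'+ => t; have : G' t < 0 by near: t; exact: h1.
by rewrite ltNge ltW// G'_gt0.
Unshelve. all: by end_near. Qed.

Lemma soliton_of_mass_low_high : mass_low -> mass_high ->
  exists (lambda : R) (u : R -> R),
    [/\ 0 < lambda,
        C2 u,
        forall x : R,
          - (u^`(2))%classic x + lambda * u x `^ (p - 1) = ray_derive F (u x)
      & (\int[lebesgue_measure]_x (u x `^ q)%:E = rho%:E)%E] /\
    [/\ (u^`())%classic \in Lfun lebesgue_measure 2%:E,
        forall x : R, 0 <= u x,
        forall x : R, u (- x) = u x,
        u x @[x --> +oo] --> 0
      & u x @[x --> -oo] --> 0].
Proof.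
move=> [m1 m01 l1] [m2 m02 l2].
have [|m m0m mJ] := mass_ivt a_gt0 m0_ge0 dG cG' G'_gt0 G_le0 G_gt0 (I := J) m01 m02.
  by rewrite l1.
have m_gt0 : 0 < m by exact: le_lt_trans m0m.
apply: (ray_soliton C1F p_gt1 F0 q_gt0 m_gt0 (F_gt0 m0m) _ mJ) => s /andP[s0 sm].
exact: (pot_lt a_gt0 dG G'_gt0 G_le0 G_gt0).
Qed.

End cases.

Theorem corollary1p2 (R : realType) (p q rho : R) (F : R -> R)
  (hp : 1 < p) (hq : Num.max (p / 2 - 1) 0 < q) (hrho : 0 < rho)
  (a0_C1 : C1_ray F)
  (a0_zero : F s / s `^ p @[s --> 0^'+] --> 0)
  (a0_oo : F s / s `^ p @[s --> +oo] --> +oo)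
  (a1 : forall s : R, 0 < s -> 0 < F s -> 0 < ray_derive F s * s - p * F s)
  (cases :
    [\/ [/\ m_0 F = 0,
            (K_0 p q F < k_oo p q F)%E
          & (threshold p q (k_oo p q F) < rho%:E
               < threshold p q (K_0 p q F))%E],
        [/\ m_0 F = 0,
            (K_oo p q F < k_0 p q F)%E
          & (threshold p q (k_0 p q F) < rho%:E
               < threshold p q (K_oo p q F))%E],
        [/\ 0 < m_0 F,
            (threshold p q (k_oo p q F) < I_F q F)%E
          & (threshold p q (k_oo p q F) < rho%:E < I_F q F)%E]
      | [/\ 0 < m_0 F,
            ray_derive F (m_0 F) != 0,
            (I_F q F < threshold p q (K_oo p q F))%E
          & (I_F q F < rho%:E < threshold p q (K_oo p q F))%E]]) :
  exists (lambda : R) (u : R -> R),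
    [/\ 0 < lambda,
        C2 u,
        forall x : R,
          - (u^`(2))%classic x + lambda * u x `^ (p - 1) = ray_derive F (u x)
      & (\int[lebesgue_measure]_x (u x `^ q)%:E = rho%:E)%E] /\
    [/\ (u^`())%classic \in Lfun lebesgue_measure 2%:E,
        forall x : R, 0 <= u x,
        forall x : R, u (- x) = u x,
        u x @[x --> +oo] --> 0
      & u x @[x --> -oo] --> 0].
Proof.
have /andP[q1 q_gt0] : (p / 2 - 1 < q) && (0 < q) by rewrite -gt_max.
have a_gt0 : 0 < q - p / 2 + 1 by lra.
(* In cases (i) to (iv), masses below the target are found for maxima near +oo, 0, +oo, [m_0 F], and
   masses above it near 0, +oo, [m_0 F], +oo. *)
apply: soliton_of_mass_low_high => //.
- case: cases => [[m00 _ /andP[lt gt]]|[m00 _ /andP[lt gt]]|[m00 _ /andP[lt gt]]|[m00 dF _ /andP[lt gt]]].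
  + by apply: low_k_oo => //; exact: threshold_lt.
  + by apply: low_k_0 => //; exact: threshold_lt.
  + by apply: low_k_oo => //; exact: threshold_lt.
  + exact: low_I_F.
- case: cases => [[m00 _ /andP[lt gt]]|[m00 _ /andP[lt gt]]|[m00 _ /andP[lt gt]]|[m00 dF _ /andP[lt gt]]].
  + by apply: high_K_0 => //; exact: threshold_gt.
  + by apply: high_K_oo => //; exact: threshold_gt.
  + exact: high_I_F.
  + by apply: high_K_oo => //; exact: threshold_gt.
Qed.
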